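(* Let $r\in(0,1]$, $\alpha\in(0,1]$ and $\mu>0$. Then the generalized negative binomial distribution with parameters $r,\alpha,\mu$ is a $Y_{r,\alpha,\mu}$-mixed geometric distribution: $$\mathsf P(N_{r,\alpha,\mu}=k)=\int_0^1 y(1-y)^k\,d\mathsf P(Y_{r,\alpha,\mu}<y),\qquad k=0,1,2,\dots,$$ where $$Y_{r,\alpha,\mu}\stackrel{d}{=}\frac{S_{\alpha,1}Z_{r,\mu}^{1/\alpha}}{1+S_{\alpha,1}Z_{r,\mu}^{1/\alpha}}\stackrel{d}{=}\frac{\mu^{1/\alpha}S_{\alpha,1}(G_{r,1}+G_{1-r,1})^{1/\alpha}}{G_{r,1}^{1/\alpha}+\mu^{1/\alpha}S_{\alpha,1}(G_{r,1}+G_{1-r,1})^{1/\alpha}},$$ with $S_{\alpha,1}$ and $Z_{r,\mu}$ independent, respectively $S_{\alpha,1}$, $G_{r,1}$, $G_{1-r,1}$ independent.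
   Context: For $r>0$, $\lambda>0$ and real $\alpha\ne0$, the generalized gamma distribution has density $g^*(x;r,\alpha,\lambda)=\frac{|\alpha|\lambda^r}{\Gamma(r)}x^{\alpha r-1}e^{-\lambda x^{\alpha}}$, $x\ge0$. A random variable $N_{r,\alpha,\mu}$ has the generalized negative binomial (GNB) distribution if $\mathsf P(N_{r,\alpha,\mu}=k)=\frac1{k!}\int_0^\infty e^{-z}z^k g^*(z;r,\alpha,\mu)\,dz$, $k=0,1,2,\dots$ (a Poisson distribution mixed over a GG law). $G_{s,1}$ denotes a gamma random variable with density $\frac{1}{\Gamma(s)}x^{s-1}e^{-x}$, $x\ge0$, for $s>0$, and $G_{0,1}:=0$. For $0<\alpha\le1$, $S_{\alpha,1}$ is a random variable with characteristic function $\exp\{-|t|^{\alpha}\exp(-\tfrac12 i\pi\alpha\,\mathrm{sign}\,t)\}$ (degenerate at $1$ when $\alpha=1$). For $r\in(0,1]$, $\mu>0$: $Z_{r,\mu}=\mu(G_{r,1}+G_{1-r,1})/G_{r,1}$ with independent gamma factors (so $Z_{1,\mu}=\mu$). If $Y$ is a random variable with values in $(0,1)$, a random variable $V$ has the $Y$-mixed geometric distribution if $\mathsf P(V=k)=\int_0^1 y(1-y)^k\,d\mathsf P(Y<y)$, $k\ge0$. *)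

(* Defs.v *)
From HB Require Import structures.
From mathcomp Require Import all_boot all_order all_algebra.
From mathcomp Require Import all_classical all_reals all_analysis.
Set Implicit Arguments. Unset Strict Implicit. Unset Printing Implicit Defensive.
Import Order.TTheory GRing.Theory Num.Theory.
Local Open Scope classical_set_scope.
Local Open Scope ring_scope.

Section defs.
Variable R : realType.

Definition Gamma (s : R) : R :=
  fine (\int[@lebesgue_measure R]_(x in `[0%R, +oo[) (x `^ (s - 1) * expR (- x))%:E)%E.

Definition gg_density (r alpha lambda x : R) : R :=
  `|alpha| * lambda `^ r / Gamma r * x `^ (alpha * r - 1) * expR (- lambda * x `^ alpha).

(* P(N_{r,alpha,mu} = k): Poisson mixed over the GG law *)
Definition GNB_pmf (r alpha mu : R) (k : nat) : \bar R :=
  (\int[@lebesgue_measure R]_(z in `[0%R, +oo[)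
     (expR (- z) * z ^+ k * gg_density r alpha mu z / (k`!)%:R)%:E)%E.

(* the law of G_{s,1}: gamma law with density x^(s-1) e^(-x)/Gamma(s) on [0,oo)
   for s > 0, and the Dirac mass at 0 for s = 0 (G_{0,1} := 0) *)
Definition gamma_law (s : R) (A : set R) : \bar R :=
  if s == 0 then ((\1_A (0 : R) : R)%:E)
  else (\int[@lebesgue_measure R]_(x in (A `&` `[0%R, +oo[))
          ((x : R) `^ (s - 1) * expR (- x) / Gamma s)%:E)%E.

(* X has characteristic function exp{-|t|^alpha exp(-i pi alpha sign t / 2)},
   written via real and imaginary parts:
   E cos(tX) = exp(-|t|^a cos(pi a/2)) cos(|t|^a sin(pi a/2)),
   E sin(tX) = exp(-|t|^a cos(pi a/2)) sign(t) sin(|t|^a sin(pi a/2)). *)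
Definition stable_charfun d (T : measurableType d) (P : probability T R)
    (alpha : R) (X : T -> R) : Prop :=
  forall t : R,
    (\int[P]_w (cos (t * X w))%:E)%E =
      (expR (- (`|t| `^ alpha * cos (pi * alpha / 2)))
        * cos (`|t| `^ alpha * sin (pi * alpha / 2)))%:E /\
    (\int[P]_w (sin (t * X w))%:E)%E =
      (expR (- (`|t| `^ alpha * cos (pi * alpha / 2)))
        * (Num.sg t * sin (`|t| `^ alpha * sin (pi * alpha / 2))))%:E.

Definition indep3 d (T : measurableType d) (P : probability T R)
    (X Y Z : T -> R) : Prop :=
  forall A B C : set R, measurable A -> measurable B -> measurable C ->
    P (X @^-1` A `&` Y @^-1` B `&` Z @^-1` C) =
    (P (X @^-1` A) * P (Y @^-1` B) * P (Z @^-1` C))%E.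

End defs.

(* Main.v *)
(** With W = S Z^(1/alpha) and Y = W / (1 + W), one has y (1 - y)^k = W / (1 + W)^(k+1), so
    everything reduces to the moments E[X / (s + X)^(k+1)] of a one-sided stable X and to
    E[Z e^(-u Z)].

    Integrating the characteristic function of s + X against e^(-d t) gives
    E[1 / (d - i (s + X))] as an oscillating integral over a ray of the complex plane;
    rotating the ray by pi/2 turns it into an integral against e^(-(s + i d) t - t^alpha).
    Its real part bounds P[|s + X| <= d] by O(d^2), which forces X >= 0, and d -> 0 gives
    E[1 / (s + X)] as the Laplace transform of e^(-t^alpha).  Letting s -> 0 shows X > 0, and
    differentiating k times in s gives all the moments.

    For Z = mu (G1 + G2) / G1, the substitution G2 = G1 v makes the two gamma densities
    collapse: E[Z e^(-u Z)] = mu^r u^(r-1) e^(-mu u) / Gamma r.  At u = t^alpha this is,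
    up to the Weibull factor, the generalized gamma density. *)

Require Import Defs.
From HB Require Import structures.
From mathcomp Require Import all_boot all_order all_algebra.
From mathcomp Require Import all_classical all_reals all_analysis.
From mathcomp Require Import measurable_realfun ring lra.
Set Implicit Arguments. Unset Strict Implicit. Unset Printing Implicit Defensive.
Import Order.TTheory GRing.Theory Num.Theory.
Import numFieldNormedType.Exports.
Local Open Scope classical_set_scope.
Local Open Scope ring_scope.

(** * Differentiation and integration on the half-line *)

(** Only the characteristic function of the stable variable is given: no density, no Laplace
    transform, and not even its sign. The rotation is what makes the limit d -> 0 possible, since on
    the original ray the damping e^(-d t) disappears with d, while on the rotated one e^(-s t)
    remains. Everything stays over the reals. A phase [phi] is carried along instead of complex
    values: [phi] = 0 extracts the real part of the resolvent and [phi] = - pi / 2 its imaginary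
    part. The formula for the moments is the one suggested by E[X e^(-t X)] = a t^(a-1) e^(-t^a),
    minus the derivative of the Laplace transform e^(-t^a), together with 1 / (s + X)^(k+1) = int
    t^k / k! e^(-(s + X) t) dt. Convergence of the Gamma integrals is not proved by analysis either:
    it follows from the assumed gamma variables, whose laws have total mass one. *)

Definition has_deriv {R : realType} (f : R -> R) (df x : R) : Prop :=
  is_derive x 1 f df.

Section derivation_rules.
Context {R : realType}.
Implicit Types f g : R -> R.

(** Lets [der] build the derivative in whatever form the rules produce, as an existential variable;
    the comparison with the wanted expression is left to [ring] or [field]. *)
Lemma has_deriv_eq f df df' x : has_deriv f df x -> df = df' -> has_deriv f df' x.
Proof. by move=> h <-. Qed.

Lemma has_deriv_id x : has_deriv (fun y : R => y) 1 x.
Proof. exact: is_derive_id. Qed.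

Lemma has_deriv_cst (c x : R) : has_deriv (fun _ : R => c) 0 x.
Proof. exact: is_derive_cst. Qed.

Lemma has_derivD f g df dg x : has_deriv f df x -> has_deriv g dg x ->
  has_deriv (fun y => f y + g y) (df + dg) x.
Proof. by move=> hf hg; exact: is_deriveD. Qed.

Lemma has_derivN f df x : has_deriv f df x ->
  has_deriv (fun y => - f y) (- df) x.
Proof. by move=> hf; exact: is_deriveN. Qed.

Lemma has_derivM f g df dg x : has_deriv f df x -> has_deriv g dg x ->
  has_deriv (fun y => f y * g y) (df * g x + f x * dg) x.
Proof.
move=> hf hg; apply: (has_deriv_eq (df := f x *: dg + g x *: df)).
  exact: is_deriveM.
by rewrite /GRing.scale /= addrC (mulrC (g x)).
Qed.

Lemma has_derivX f df x n : has_deriv f df x ->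
  has_deriv (fun y => f y ^+ n) (n%:R * f x ^+ n.-1 * df) x.
Proof.
move=> hf; apply: (has_deriv_eq (df := (n%:R * f x ^+ n.-1) *: df)) => //.
rewrite (_ : (fun y => f y ^+ n) = f ^+ n); first exact: is_deriveX.
by apply/funext => y; rewrite exprfctE.
Qed.

Lemma has_deriv_comp (h : R -> R) f df dh x : has_deriv h dh (f x) ->
  has_deriv f df x -> has_deriv (fun y => h (f y)) (dh * df) x.
Proof. by move=> hh hf; exact: is_derive1_comp. Qed.

Lemma has_deriv_expR f df x : has_deriv f df x ->
  has_deriv (fun y => expR (f y)) (expR (f x) * df) x.
Proof. by move=> hf; exact: (has_deriv_comp (is_derive_expR _) hf). Qed.

Lemma has_deriv_cos f df x : has_deriv f df x ->
  has_deriv (fun y => cos (f y)) (- sin (f x) * df) x.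
Proof. by move=> hf; exact: (has_deriv_comp (is_derive_cos _) hf). Qed.

Lemma has_deriv_sin f df x : has_deriv f df x ->
  has_deriv (fun y => sin (f y)) (cos (f x) * df) x.
Proof. by move=> hf; exact: (has_deriv_comp (is_derive_sin _) hf). Qed.

Lemma has_deriv_powR f df x a : 0 < f x -> has_deriv f df x ->
  has_deriv (fun y => f y `^ a) (a * f x `^ (a - 1) * df) x.
Proof. by move=> fx0 hf; exact: (has_deriv_comp (is_derive1_powR a fx0) hf). Qed.

Lemma has_derivV f df x : f x != 0 -> has_deriv f df x ->
  has_deriv (fun y => (f y)^-1) (- df * (f x)^-1 ^+ 2) x.
Proof.
move=> fx0 hf; apply: (has_deriv_eq (df := - (f x) ^- 2 *: df)).
  exact: is_deriveV.
by rewrite /GRing.scale /= exprVn; ring.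
Qed.

Lemma has_deriv_continuous f df x : has_deriv f df x -> {for x, continuous f}.
Proof. by move=> [h _]; apply/differentiable_continuous/derivable1_diffP. Qed.

Lemma measurable_inv : measurable_fun setT (@GRing.inv R).
Proof.
(* Inversion is discontinuous at 0. This formula uses only measurable operations, has a nonnegative
   base for the power, and also gives 0 at 0. *)
rewrite (_ : @GRing.inv R = (fun x => x * (x ^+ 2) `^ (-1))).
  apply: measurable_funM => //.
  apply: (measurableT_comp (measurable_powR _)); exact: measurable_funX.
apply/funext => x; rewrite powR_inv1 ?sqr_ge0//.
have [->|x0] := eqVneq x 0; first by rewrite mul0r invr0.
by rewrite expr2; field.
Qed.

Lemma measurable_cos : measurable_fun setT (@cos R).
Proof. by apply: continuous_measurable_fun => x; exact: continuous_cos. Qed.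

Lemma measurable_sin : measurable_fun setT (@sin R).
Proof. by apply: continuous_measurable_fun => x; exact: continuous_sin. Qed.

End derivation_rules.

Lemma measurable_preimage d1 d2 (T1 : measurableType d1) (T2 : measurableType d2)
    (X : T1 -> T2) (A : set T2) :
  measurable_fun setT X -> measurable A -> measurable (X @^-1` A).
Proof. by move=> mX mA; rewrite -[X in measurable X]setTI; exact: mX. Qed.

(** Computes a derivative by recursion on the body of the function. The last branch eta-expands
    functions that are not yet abstractions; the goals that remain are the side conditions of powers
    and inverses. *)
Ltac der := repeat match goal with
  | |- has_deriv (fun y => y) _ _ => apply: has_deriv_id
  | |- has_deriv (fun y => ?c) _ _ => apply: has_deriv_cst
  | |- has_deriv (fun y => @GRing.add _ _ _) _ _ => apply: has_derivD
  | |- has_deriv (fun y => @GRing.opp _ _) _ _ => apply: has_derivN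
  | |- has_deriv (fun y => @GRing.mul _ _ _) _ _ => apply: has_derivM
  | |- has_deriv (fun y => @GRing.exp _ _ _) _ _ => apply: has_derivX
  | |- has_deriv (fun y => expR _) _ _ => apply: has_deriv_expR
  | |- has_deriv (fun y => cos _) _ _ => apply: has_deriv_cos
  | |- has_deriv (fun y => sin _) _ _ => apply: has_deriv_sin
  | |- has_deriv (fun y => powR _ _) _ _ => apply: has_deriv_powR
  | |- has_deriv (fun y => @GRing.inv _ _) _ _ => apply: has_derivV
  | |- has_deriv ?f ?d ?x =>
      lazymatch f with (fun y => _) => fail | _ => change (has_deriv (fun y => f y) d x) end
  end.

Ltac dercont := eapply has_deriv_continuous; der.

Ltac mfun := repeat match goal with
  | |- measurable_fun _ (fun y => EFin _) => apply/measurable_EFinP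
  | |- measurable_fun _ (fun y => y) => exact: measurable_id
  | |- measurable_fun _ (fun y => ?c) => exact: measurable_cst
  | |- measurable_fun _ (fun y => @GRing.add _ _ _) => apply: measurable_funD
  | |- measurable_fun _ (fun y => @GRing.opp _ _) => apply: measurable_funN
  | |- measurable_fun _ (fun y => @GRing.mul _ _ _) => apply: measurable_funM
  | |- measurable_fun _ (fun y => @GRing.exp _ _ _) => apply: measurable_funX
  | |- measurable_fun _ (fun y => expR _) => apply: (measurableT_comp (@measurable_expR _))
  | |- measurable_fun _ (fun y => cos _) => apply: (measurableT_comp measurable_cos)
  | |- measurable_fun _ (fun y => sin _) => apply: (measurableT_comp measurable_sin)
  | |- measurable_fun _ (fun y => powR _ ?p) => apply: (measurableT_comp (@measurable_powR _ p))
  | |- measurable_fun _ (fun y => @GRing.inv _ _) => apply: (measurableT_comp measurable_inv)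
  | |- measurable_fun _ (fun y => @Num.norm _ _ _) =>
      apply: (measurableT_comp (@normr_measurable _ setT))
  | |- measurable_fun _ (fun y => fst _) => apply: (measurableT_comp measurable_fst)
  | |- measurable_fun _ (fun y => snd _) => apply: (measurableT_comp measurable_snd)
  | |- measurable_fun _ (fun y => ?f _) => apply: (measurableT_comp (f := f)); [assumption|]
  | _ => first [exact: measurable_fst | exact: measurable_snd | assumption
      | apply: measurable_funTS; assumption]
  | |- measurable_fun ?D ?f =>
      lazymatch f with (fun y => _) => fail
      | _ => change (measurable_fun D (fun y => f y)) end
  end.

(** * The fundamental theorem of calculus and scaling on the open half-line *)

Section half_line.
Context {R : realType}.
Local Notation mu := (@lebesgue_measure R).
Local Notation I := (`]0, +oo[%classic : set R).
Implicit Types f F : R -> R.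

(** Compact exhaustion of the half-line that avoids 0, where powers may be singular. With [n.+2] the
    segment is nondegenerate already for n = 0. *)
Let J n : set R := `[(n.+2%:R)^-1, n.+2%:R].

Let JE n x : J n x = (n.+2%:R^-1 <= x <= n.+2%:R) :> Prop.
Proof. by rewrite /J/= in_itv. Qed.

Let itvE n : J n `<=` I.
Proof.
move=> x; rewrite JE => /andP[h _].
by rewrite /= in_itv/= andbT; apply: lt_le_trans h; rewrite invr_gt0.
Qed.

Let itv_nd : nondecreasing_seq (fun n => J n).
Proof.
apply/nondecreasing_seqP => n; apply/subsetPset => x; rewrite !JE.
move=> /andP[h1 h2]; apply/andP; split.
  by apply: le_trans h1; rewrite lef_pV2 ?posrE// ler_nat.
by apply: le_trans h2 _; rewrite ler_nat.
Qed.

Let itv_bigcup : \bigcup_n J n = I.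
Proof.
apply/seteqP; split => [x [n _ /itvE//]|x].
rewrite /= in_itv/= andbT => x0.
exists (Num.truncn (Num.max x x^-1)) => //; rewrite JE.
set m := Num.max x x^-1.
have hm : m <= (Num.truncn m).+2%:R.
  apply: ltW; apply: lt_trans (truncnS_gt _) _; by rewrite ltr_nat.
apply/andP; split; last by apply: le_trans hm; rewrite /m le_max lexx.
by rewrite invf_ple ?posrE//; apply: le_trans hm; rewrite /m le_max lexx orbT.
Qed.

Let FTC_itv f F n : (forall x, 0 < x -> has_deriv F (f x) x) ->
  (forall x, 0 < x -> {for x, continuous f}) ->
  (\int[mu]_(x in J n) (f x)%:E =
   (F n.+2%:R - F (n.+2%:R^-1))%R%:E)%E.
Proof.
move=> dF cf.
have p0 (x : R) : n.+2%:R^-1 <= x -> 0 < x by apply: lt_le_trans; rewrite invr_gt0.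
have h12 : (n.+2%:R : R)^-1 < n.+2%:R.
  by apply: (@lt_trans _ _ 1); rewrite ?ltr1n// invf_lt1// ltr1n.
rewrite (@continuous_FTC2 _ f F) ?EFinB//.
- apply: continuous_in_subspaceT => x; rewrite inE/= in_itv/= => /andP[h _].
  exact/cf/p0.
- split => [x|  |].
  + by rewrite in_itv/= => /andP[/ltW/p0 h _]; case: (dF x h).
  + apply: cvg_at_right_filter; apply: (has_deriv_continuous (dF _ _)).
    by rewrite invr_gt0.
  + by apply: cvg_at_left_filter; apply: (has_deriv_continuous (dF _ _)).
- move=> x; rewrite in_itv/= => /andP[/ltW/p0 h _].
  by rewrite derive1E; have [_ ->] := dF x h.
Qed.

Let cvg_itv F (l0 l1 : R) : F x @[x --> 0^'+] --> l0 -> F x @[x --> +oo] --> l1 ->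
  ((F n.+2%:R - F n.+2%:R^-1)%R%:E @[n --> \oo] --> (l1 - l0)%:E)%E.
Proof.
move=> F0 F1; apply: cvg_EFin; first exact: nearW.
have yy : (n.+2%:R : R) @[n --> \oo] --> +oo.
  have := @cvgr_idn R; rewrite -(cvg_shiftn 2).
  by under eq_fun do rewrite addn2.
apply: cvgB.
  by move/cvg_pinftyP : F1 => /(_ _ yy).
move/cvg_at_rightP : F0 => /(_ (fun n => n.+2%:R^-1)); apply; split => //.
apply/gtr0_cvgV0; first exact: nearW.
exact: yy.
Qed.

(** Monotone convergence along the exhaustion [J]. Integrability is a conclusion here, whereas the
    next lemma, for integrands of any sign, assumes it and uses dominated convergence. *)
Lemma ge0_FTC_half_line f F l0 l1 : (forall x, 0 < x -> 0 <= f x) ->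
  (forall x, 0 < x -> has_deriv F (f x) x) ->
  (forall x, 0 < x -> {for x, continuous f}) ->
  F x @[x --> 0^'+] --> l0 -> F x @[x --> +oo] --> l1 ->
  (\int[mu]_(x in I) (f x)%:E = (l1 - l0)%:E)%E.
Proof.
move=> f0 dF cf F0 F1.
rewrite -itv_bigcup; rewrite -(cvg_lim _ (cvg_itv F0 F1))//; apply/esym/cvg_lim => //.
under eq_cvg => n do rewrite -(FTC_itv n dF cf).
apply: (@ge0_nondecreasing_set_cvg_integral _ (measurableTypeR R) _ J (EFin \o f) mu itv_nd).
  by move=> n; exact: measurable_itv.
  move=> n; apply/measurable_EFinP.
  apply: (@measurable_funS _ _ _ _ I) => //.
  apply: open_continuous_measurable_fun => // x.
  by rewrite inE/= in_itv/= andbT => /cf.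
move=> n x /itvE; rewrite /= in_itv/= andbT => /f0; by rewrite lee_fin.
Qed.

Lemma integrable_FTC_half_line f F l0 l1 : mu.-integrable I (EFin \o f) ->
  (forall x, 0 < x -> has_deriv F (f x) x) ->
  (forall x, 0 < x -> {for x, continuous f}) ->
  F x @[x --> 0^'+] --> l0 -> F x @[x --> +oo] --> l1 ->
  (\int[mu]_(x in I) (f x)%:E = (l1 - l0)%:E)%E.
Proof.
move=> intf dF cf F0 F1.
rewrite -(cvg_lim _ (cvg_itv F0 F1))//; apply/esym/cvg_lim => //.
under eq_cvg => n do rewrite -(FTC_itv n dF cf).
rewrite (_ : (fun n => _) = (fun n => \int[mu]_(x in I) ((EFin \o f) \_ (J n)) x)%E); last first.
  apply/funext => n; rewrite -integral_mkcondr; congr (integral _ _ _).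
  by rewrite setIidr//; exact: itvE.
have mf : measurable_fun I (EFin \o f) := measurable_int mu intf.
have mJ n : measurable_fun I ((EFin \o f) \_ (J n)).
  apply/(measurable_restrict _ (measurable_itv _) (measurable_itv _)).
  by apply: measurable_funS mf => //; exact: subIsetl.
have cJ : {ae mu, forall x, I x -> ((EFin \o f) \_ (J n)) x @[n --> \oo] --> (f x)%:E}.
  apply: aeW => x Ix; apply: cvg_near_cst.
  move: (Ix); rewrite -itv_bigcup => -[m _ Jmx].
  exists m => // n mn /=; rewrite patchE mem_set//.
  by have /subsetPset := itv_nd mn; exact.
have dJ : {ae mu, forall x n, I x -> `|((EFin \o f) \_ (J n)) x| <= `|(f x)%:E|}%E.
  apply: aeW => x n Ix; rewrite patchE; case: ifP => // _.
  by rewrite abse0 abse_ge0.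
by have [_ _] := @dominated_convergence _ (measurableTypeR R) R mu I
  (measurable_itv _) _ _ (abse \o (EFin \o f)) mJ mf cJ (integrable_abse intf) dJ.
Qed.

(** Lebesgue measure is c times its pushforward under multiplication by c, by uniqueness on
    half-open intervals. No regularity of f beyond measurability is required. *)
Lemma integral_half_line_scale (f : R -> \bar R) (c : R) : 0 < c ->
  measurable_fun setT f -> (forall x, 0 < x -> (0 <= f x)%E) ->
  (\int[mu]_(x in I) f x = c%:E * \int[mu]_(x in I) f (c * x)%R)%E.
Proof.
move=> c0 mf f0.
have mc : measurable_fun (setT : set (measurableTypeR R))
    ( *%R c : measurableTypeR R -> measurableTypeR R) by apply: measurable_funM.
pose phi : {mfun measurableTypeR R >-> measurableTypeR R} :=
  HB.pack ( *%R c : measurableTypeR R -> measurableTypeR R) (isMeasurableFun.Build _ _ _ _ _ mc).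
pose k : {nonneg R} := NngNum (ltW c0).
have muE (A : set R) : measurable A -> mu A = mscale k (pushforward mu phi) A.
  move=> mA; apply: lebesgue_measure_unique => //= _ [[a b]] _ <-.
  rewrite /mscale/= /pushforward.
  rewrite (_ : phi @^-1` `]a, b] = `](a / c), (b / c)]%classic); last first.
    apply/seteqP; split => x /=; rewrite !in_itv/= ltr_pdivrMr// ler_pdivlMr//.
      by rewrite (mulrC c).
    by rewrite (mulrC c).
  rewrite !lebesgue_measure_itv/= !lte_fin ltr_pM2r ?invr_gt0//.
  case: ifPn => _; last by rewrite mule0.
  by rewrite -EFinB -EFinM; congr EFin; field; rewrite gt_eqF.
rewrite (eq_measure_integral (mscale k (pushforward mu phi))); last first.
  by move=> A mA _; exact: muE.
rewrite ge0_integral_mscale//; last 2 first.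
- exact: measurable_funTS.
- by move=> x /=; rewrite in_itv/= andbT; exact: f0.
congr (_ * _)%E; rewrite ge0_integral_pushforward//; last 2 first.
- exact: measurable_funTS.
- by move=> x; rewrite inE/= in_itv/= andbT; exact: f0.
rewrite (_ : phi @^-1` I = I)//.
by apply/seteqP; split => x /=; rewrite !in_itv/= !andbT pmulr_rgt0.
Qed.

Lemma half_line_bigcup : \bigcup_n `[(n.+2%:R : R)^-1, n.+2%:R]%classic = I.
Proof. exact: itv_bigcup. Qed.

End half_line.

(** * Tonelli and Fubini on measurable rectangles *)

Section iterated_integrals.
Local Open Scope ereal_scope.
Context d1 d2 (T1 : measurableType d1) (T2 : measurableType d2) (R : realType).
Variable m1 : {sigma_finite_measure set T1 -> \bar R}.
Variable m2 : {sigma_finite_measure set T2 -> \bar R}.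
Variables (D1 : set T1) (D2 : set T2).
Hypotheses (mD1 : measurable D1) (mD2 : measurable D2).
Variable f : T1 -> T2 -> \bar R.
Hypothesis mf : measurable_fun setT (fun z : T1 * T2 => f z.1 z.2).

(** Extension by zero, which reduces iterated integrals over [D1] and [D2] to the whole product
    space. *)
Let g (z : T1 * T2) := ((fun z => f z.1 z.2) \_ (D1 `*` D2)) z.

Let mg : measurable_fun setT g.
Proof.
apply/(measurable_restrictT _ (measurableX mD1 mD2)).
exact: measurable_funTS.
Qed.

(** The map [h] is either the identity or the absolute value, so that one proof serves both the
    integral and its integrability condition. *)
Let g1 (h : \bar R -> \bar R) (h0 : h 0 = 0) :
  \int[m1]_x \int[m2]_y h (g (x, y)) =
  \int[m1]_(x in D1) \int[m2]_(y in D2) h (f x y).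
Proof.
rewrite [RHS]integral_mkcond; apply: eq_integral => x _.
rewrite [RHS]patchE; case: ifPn => xD1.
  rewrite [RHS]integral_mkcond; apply: eq_integral => y _.
  by rewrite /g !patchE in_setX xD1/=; case: ifPn.
rewrite integral0_eq// => y _.
by rewrite /g patchE in_setX (negbTE xD1).
Qed.

Let g2 (h : \bar R -> \bar R) (h0 : h 0 = 0) :
  \int[m2]_y \int[m1]_x h (g (x, y)) =
  \int[m2]_(y in D2) \int[m1]_(x in D1) h (f x y).
Proof.
rewrite [RHS]integral_mkcond; apply: eq_integral => y _.
rewrite [RHS]patchE; case: ifPn => yD2.
  rewrite [RHS]integral_mkcond; apply: eq_integral => x _.
  by rewrite /g !patchE in_setX yD2 andbT; case: ifPn.
rewrite integral0_eq// => x _.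
by rewrite /g patchE in_setX (negbTE yD2) andbF.
Qed.

Lemma tonelli_in : (forall x y, D1 x -> D2 y -> 0 <= f x y) ->
  \int[m1]_(x in D1) \int[m2]_(y in D2) f x y =
  \int[m2]_(y in D2) \int[m1]_(x in D1) f x y.
Proof.
move=> f0; rewrite -(g1 (h := id))// -(g2 (h := id))//.
apply: fubini_tonelli => // -[x y]; rewrite /g; apply: erestrict_ge0.
by move=> [a b] /= [? ?]; exact: f0.
Qed.

Lemma fubini_in :
  \int[m1]_(x in D1) \int[m2]_(y in D2) `|f x y| < +oo ->
  \int[m1]_(x in D1) \int[m2]_(y in D2) f x y =
  \int[m2]_(y in D2) \int[m1]_(x in D1) f x y.
Proof.
move=> foo; rewrite -(g1 (h := id))// -(g2 (h := id))//.
apply: Fubini; apply/integrable12ltyP => //.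
by rewrite (g1 (h := abse)) ?abse0.
Qed.

Lemma measurable_integral_in : (forall x y, D1 x -> D2 y -> 0 <= f x y) ->
  measurable_fun D1 (fun x => \int[m2]_(y in D2) f x y).
Proof.
move=> f0; apply/(measurable_restrictT _ mD1).
rewrite (_ : _ \_ _ = fubini_F m2 g).
  apply: measurable_fun_fubini_tonelli_F => // -[x y]; rewrite /g; apply: erestrict_ge0.
  by move=> [a b] /= [? ?]; exact: f0.
apply/funext => x; rewrite patchE /fubini_F; case: ifPn => xD1.
  rewrite [LHS]integral_mkcond; apply: eq_integral => y _.
  by rewrite /g !patchE in_setX xD1/=; case: ifPn.
rewrite integral0_eq// => y _.
by rewrite /g patchE in_setX (negbTE xD1).
Qed.

End iterated_integrals.

Section fubini_dominated.
Local Open Scope ereal_scope.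
Context d1 d2 (T1 : measurableType d1) (T2 : measurableType d2) (R : realType).
Variable m1 : {sigma_finite_measure set T1 -> \bar R}.
Variable m2 : {sigma_finite_measure set T2 -> \bar R}.
Variables (D1 : set T1) (D2 : set T2).
Hypotheses (mD1 : measurable D1) (mD2 : measurable D2) (D2oo : m2 D2 < +oo).

(** The shape of every signed exchange below: an exponential bound in the half-line variable,
    uniform in a second variable of finite total mass (an interval of angles or a probability
    space). *)
Lemma fubini_dominated (f : T1 -> T2 -> R) (g : T1 -> R) :
  measurable_fun setT (fun z : T1 * T2 => f z.1 z.2) ->
  m1.-integrable D1 (EFin \o g) ->
  (forall x y, D1 x -> D2 y -> `|f x y| <= g x)%R ->
  \int[m1]_(x in D1) \int[m2]_(y in D2) (f x y)%:E =
  \int[m2]_(y in D2) \int[m1]_(x in D1) (f x y)%:E.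
Proof.
move=> mf ig fg; have mg := measurable_int m1 ig.
apply: (@fubini_in _ _ _ _ R m1 m2 D1 D2 mD1 mD2 (fun x y => (f x y)%:E)).
  exact/measurable_EFinP.
have mnf : measurable_fun setT (fun z : T1 * T2 => `|(f z.1 z.2)%:E|).
  by apply: measurableT_comp => //; exact/measurable_EFinP.
have h2 : \int[m1]_(x in D1) (m2 D2 * `|(g x)%:E|) < +oo.
  rewrite ge0_integralZl//; last exact: measurableT_comp.
  by rewrite lte_mul_pinfty// ?ge0_fin_numE//; case/integrableP: ig.
apply: le_lt_trans h2; apply: ge0_le_integral => //.
- by move=> x _; apply: integral_ge0 => y _; exact: abse_ge0.
- exact: (@measurable_integral_in _ _ _ _ R m2 D1 D2 mD1 mD2 (fun x y => `|(f x y)%:E|)).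
- by apply: measurable_funeM; exact: measurableT_comp.
- move=> x Dx; rewrite muleC -integral_cst//.
  apply: ge0_le_integral => //.
  + apply: measurable_funTS.
    exact: (measurable_fun_pair2 (f := fun z : T1 * T2 => `|(f z.1 z.2)%:E|)).
  + by move=> y Dy; rewrite lee_fin; apply: le_trans (fg _ _ Dx Dy) _; exact: ler_norm.
Qed.

End fubini_dominated.

(** * Exponentially dominated functions on the half-line *)

Section exponential_bounds.
Context {R : realType}.
Local Notation mu := (@lebesgue_measure R).
Local Notation I := (`]0, +oo[%classic : set R).
Implicit Types f F : R -> R.

Lemma expR_cvg_pinfty0 (m : R) : 0 < m -> expR (- m * t) @[t --> +oo] --> (0 : R).
Proof.
move=> m0; have h : m * t @[t --> +oo] --> +oo by apply: gt0_cvgMry => //; exact: cvg_id.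
have := cvg_comp _ _ h (@cvgr_expR R).
rewrite (_ : _ \o _ = (fun t => expR (- m * t)))//.
by apply/funext => t /=; rewrite mulNr.
Qed.

Lemma cvg_pinfty_expR_dom F (C m : R) : 0 < m ->
  (forall t, 0 < t -> `|F t| <= C * expR (- m * t)) -> F t @[t --> +oo] --> (0 : R).
Proof.
move=> m0 FC; apply: norm_cvg0.
apply: (@squeeze_cvgr _ _ _ _ (fun=> 0) (fun t => C * expR (- m * t))).
- near=> t; rewrite normr_ge0 FC//; near: t; exact: nbhs_pinfty_gt.
- exact: cvg_cst.
- rewrite -(mulr0 C); apply: cvgMr => //; exact: expR_cvg_pinfty0.
Unshelve. all: end_near. Qed.

Lemma cvg_at_right0_lin_dom F (C : R) : (forall t, 0 < t -> `|F t| <= C * t) ->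
  F t @[t --> 0^'+] --> (0 : R).
Proof.
move=> FC; apply: norm_cvg0.
apply: (@squeeze_cvgr _ _ _ _ (fun=> 0) (fun t => C * t)).
- near=> t; rewrite normr_ge0 FC//.
- exact: cvg_cst.
- rewrite -[X in _ --> X](mulr0 C); apply: cvgMr => //; exact: cvg_at_right_filter.
Unshelve. all: end_near. Qed.

Lemma integral_expR_half_line (m : R) : 0 < m ->
  (\int[mu]_(t in I) (expR (- m * t))%:E = (m^-1)%:E)%E.
Proof.
move=> m0.
rewrite (@ge0_FTC_half_line _ (fun t => expR (- m * t))
  (fun t => - m^-1 * expR (- m * t)) (- m^-1) 0)//.
- by rewrite sub0r opprK.
- move=> x _; apply: has_deriv_eq; [by der|cbv beta].
  by field; rewrite gt_eqF.
- by move=> x _; dercont.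
- have c : {for (0 : R), continuous (fun t => - m^-1 * expR (- m * t))} by dercont.
  by have := cvg_at_right_filter c; rewrite mulr0 expR0 mulr1.
- rewrite -(mulr0 (- m^-1)); apply: cvgMr => //; exact: expR_cvg_pinfty0.
Qed.

Lemma integrable_expR_half_line (m : R) : 0 < m ->
  mu.-integrable I (EFin \o (fun t => expR (- m * t))).
Proof.
move=> m0; apply/integrableP; split.
  by apply/measurable_EFinP; mfun.
under eq_integral do rewrite /= ger0_norm ?expR_ge0//.
by rewrite integral_expR_half_line// ltry.
Qed.

Lemma integrable_expR_dom f (C m : R) : 0 < m -> measurable_fun I f ->
  (forall t, 0 < t -> `|f t| <= C * expR (- m * t)) -> mu.-integrable I (EFin \o f).
Proof.
move=> m0 mf fC.
apply: (@le_integrable _ _ _ mu I _ _ (EFin \o (fun t => C * expR (- m * t)))) => //.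
- exact/measurable_EFinP.
- move=> t /=; rewrite in_itv/= andbT => t0; rewrite lee_fin.
  by apply: le_trans (fC _ t0) _; exact: ler_norm.
- rewrite (_ : EFin \o _ = (fun t => C%:E * (EFin \o (fun t => expR (- m * t))) t)%E)//.
  exact/integrableZl/integrable_expR_half_line.
Qed.

(** Half of the exponential rate absorbs the factor t, through x <= e^x at x = m t / 2. *)
Lemma mul_expRN_le (m t : R) : 0 < m -> t * expR (- m * t) <= 2 / m * expR (- (m / 2) * t).
Proof.
move=> m0.
have -> : - m * t = - (m / 2) * t + - (m / 2) * t by field.
rewrite expRD mulrA ler_wpM2r ?expR_ge0//.
have h : m / 2 * t <= expR (m / 2 * t) by apply: le_trans (expR_ge1Dx _); lra.
rewrite mulNr expRN ler_pdivrMr ?expR_gt0//.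
rewrite mulrAC ler_pdivlMr//; lra.
Qed.

Lemma powR_le1D (a t : R) : 0 < a <= 1 -> 0 < t -> t `^ a <= 1 + t.
Proof.
move=> /andP[a0 a1] t0; have [t1|t1] := leP t 1.
  have : t `^ a <= t `^ 0 by apply: ger_powR; rewrite ?t0 ?t1// ltW.
  by rewrite powRr0; lra.
by have := ler1_powR (ltW t1) a1; lra.
Qed.

Lemma FTC_segment f F (a b : R) : a < b -> (forall x, has_deriv F (f x) x) ->
  continuous f -> (\int[mu]_(x in `[a, b]) (f x)%:E = (F b - F a)%:E)%E.
Proof.
move=> ab dF cf; rewrite (@continuous_FTC2 _ f F) ?EFinB//.
- exact: continuous_subspaceT.
- split => [x _| |]; first by case: (dF x).
  + exact/cvg_at_right_filter/(has_deriv_continuous (dF _)).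
  + exact/cvg_at_left_filter/(has_deriv_continuous (dF _)).
- by move=> x _; rewrite derive1E; have [_ ->] := dF x.
Qed.

End exponential_bounds.

(* Contour rotation: integrating [exp (- (s + i d) w - w ^ a)] along the ray
   [w = r e^(i (psi - pi/2))] gives the same value for every [psi] in [0, pi/2].
   [A] and [B] are the real and imaginary parts of the exponent, up to sign and
   phase, and the identity [d_psi K = - d_t (t e^(-A) sin (B + phi))] replaces
   Cauchy's theorem. *)
Section ray_rotation.
Context {R : realType}.
Local Notation mu := (@lebesgue_measure R).
Local Notation I := (`]0, +oo[%classic : set R).
Variables d s a phi : R.
Hypotheses (d0 : 0 < d) (s0 : 0 < s) (ha : 0 < a <= 1).

Let A (t psi : R) := t * (d * cos psi + s * sin psi) + t `^ a * cos (a * (pi / 2 - psi)).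
Let B (t psi : R) :=
  psi - t * (d * sin psi - s * cos psi) + t `^ a * sin (a * (pi / 2 - psi)).
Let K (t psi : R) := expR (- A t psi) * cos (B t psi + phi).
Let A' (t psi : R) :=
  t * (s * cos psi - d * sin psi) + a * t `^ a * sin (a * (pi / 2 - psi)).
Let B' (t psi : R) :=
  1 - t * (d * cos psi + s * sin psi) - a * t `^ a * cos (a * (pi / 2 - psi)).
Let L (t psi : R) := - (expR (- A t psi) *
  (A' t psi * cos (B t psi + phi) + B' t psi * sin (B t psi + phi))).
Let m := Num.min d s.

Let m0 : 0 < m. Proof. by rewrite lt_min d0. Qed.

Let dK t psi : has_deriv (K t) (L t psi) psi.
Proof.
rewrite /K /A /B; apply: has_deriv_eq; [by der|cbv beta].
rewrite /L /A' /B' /A /B; ring.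
Qed.

Let dL t psi : 0 < t ->
  has_deriv (fun t => - (t * expR (- A t psi) * sin (B t psi + phi))) (L t psi) t.
Proof.
move=> t0; rewrite /A /B; apply: has_deriv_eq; [by der|cbv beta].
(* For [ring] the powers with exponents a and a - 1 are unrelated atoms, so the first is expressed
   through the second, here and again after [L] is unfolded. *)
have -> : t `^ a = t * t `^ (a - 1) by rewrite mulr_powRB1//; [exact: ltW|case/andP: ha].
rewrite /L /A' /B' /A /B.
have -> : t `^ a = t * t `^ (a - 1) by rewrite mulr_powRB1//; [exact: ltW|case/andP: ha].
ring.
Qed.

(** Decay uniform in the angle: cos psi + sin psi >= 1 on the quarter turn, and the power term is
    nonnegative because a <= 1 keeps its angle within [0, pi / 2]. *)
Let A_ge t psi : 0 < t -> 0 <= psi <= pi / 2 -> m * t <= A t psi.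
Proof.
move=> t0 /andP[p0 p1]; have pi0 := @pi_gt0 R; have /andP[a0 a1] := ha.
have c0 : 0 <= cos psi by apply: cos_ge0_pihalf; apply/andP; split; lra.
have si0 : 0 <= sin psi by apply: sin_ge0_pi; apply/andP; split; lra.
have h : 0 <= cos (a * (pi / 2 - psi)).
  have h0 : 0 <= a * (pi / 2 - psi) by apply: mulr_ge0; lra.
  have h1 : a * (pi / 2 - psi) <= 1 * (pi / 2 - psi) by apply: ler_wpM2r; lra.
  by apply: cos_ge0_pihalf; apply/andP; split; lra.
have hp : 0 <= t `^ a * cos (a * (pi / 2 - psi)) by rewrite mulr_ge0// powR_ge0.
have cs : 1 <= cos psi + sin psi.
  have := cos2Dsin2 psi; have := cos_le1 psi; have := sin_le1 psi; nra.
have md : m <= d by rewrite ge_min lexx.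
have ms : m <= s by rewrite ge_min lexx orbT.
have : m <= d * cos psi + s * sin psi.
  have := ler_wpM2r c0 md; have := ler_wpM2r si0 ms.
  have := ler_wpM2l (ltW m0) cs; rewrite mulr1 mulrDr; lra.
move=> /(ler_wpM2r (ltW t0)); rewrite /A; lra.
Qed.

Let expA_le t psi : 0 < t -> 0 <= psi <= pi / 2 -> expR (- A t psi) <= expR (- m * t).
Proof. by move=> t0 hp; rewrite ler_expR mulNr lerN2 A_ge. Qed.

Let K_le t psi : 0 < t -> 0 <= psi <= pi / 2 -> `|K t psi| <= 1 * expR (- m * t).
Proof.
move=> t0 hp; rewrite /K normrM (ger0_norm (expR_ge0 _)) mulrC.
apply: ler_pM => //; last exact: expA_le.
by rewrite ler_norml cos_geN1 cos_le1.
Qed.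

(** The bounds on [A'] and [B'] add up to 3 + 2 (d + s + 1) t; trading t for half of the rate by
    [mul_expRN_le] contributes a further factor 2 / m. *)
Let C := 3 + 4 * (d + s + 1) / m.

Let L_le t psi : 0 < t -> 0 <= psi <= pi / 2 -> `|L t psi| <= C * expR (- (m / 2) * t).
Proof.
move=> t0 hp; have /andP[a0 a1] := ha.
have nc x : `|cos x| <= 1 :> R by rewrite ler_norml cos_geN1 cos_le1.
have ns x : `|sin x| <= 1 :> R by rewrite ler_norml sin_geN1 sin_le1.
have tp := powR_le1D ha t0.
have tp0 : 0 <= t `^ a by exact: powR_ge0.
have atp : `|a * t `^ a| <= 1 + t.
  rewrite ger0_norm; last by rewrite mulr_ge0// ltW.
  by apply: le_trans tp; rewrite -[leRHS]mul1r ler_wpM2r.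
have lin x y : `|x| <= 1 -> `|y| <= 1 -> `|t * (d * x + s * y)| <= (d + s) * t.
  move=> hx hy; rewrite normrM (ger0_norm (ltW t0)) mulrC ler_wpM2r ?(ltW t0)//.
  apply: le_trans (ler_normD _ _) _; rewrite !normrM (ger0_norm (ltW d0)) (ger0_norm (ltW s0)).
  by rewrite lerD// -[leRHS]mulr1 ler_wpM2l ?(ltW d0) ?(ltW s0).
have hA : `|A' t psi| <= (d + s + 1) * t + 1.
  rewrite /A'; apply: le_trans (ler_normD _ _) _.
  have -> : s * cos psi - d * sin psi = d * - sin psi + s * cos psi by ring.
  have h1 : `|t * (d * - sin psi + s * cos psi)| <= (d + s) * t by apply: lin; rewrite ?normrN.
  have h2 : `|a * t `^ a * sin (a * (pi / 2 - psi))| <= 1 + t.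
    by rewrite normrM -[leRHS]mulr1 ler_pM.
  lra.
have hB : `|B' t psi| <= (d + s + 1) * t + 2.
  rewrite /B'; apply: le_trans (ler_normB _ _) _.
  have h1 : `|1 - t * (d * cos psi + s * sin psi)| <= 1 + (d + s) * t.
    by apply: le_trans (ler_normB _ _) _; rewrite normr1 lerD2l lin.
  have h2 : `|a * t `^ a * cos (a * (pi / 2 - psi))| <= 1 + t.
    by rewrite normrM -[leRHS]mulr1 ler_pM.
  lra.
rewrite /L normrN normrM (ger0_norm (expR_ge0 _)) mulrC.
apply: (@le_trans _ _ ((3 + 2 * (d + s + 1) * t) * expR (- m * t))).
  apply: ler_pM => //; last exact: expA_le.
  apply: le_trans (ler_normD _ _) _; rewrite !normrM.
  have h1 : `|A' t psi| * `|cos (B t psi + phi)| <= (d + s + 1) * t + 1.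
    by rewrite -[leRHS]mulr1 ler_pM.
  have h2 : `|B' t psi| * `|sin (B t psi + phi)| <= (d + s + 1) * t + 2.
    by rewrite -[leRHS]mulr1 ler_pM.
  lra.
have e1 : expR (- m * t) <= expR (- (m / 2) * t).
  rewrite ler_expR !mulNr lerN2 ler_wpM2r ?(ltW t0)//; have := m0; lra.
have := mul_expRN_le t m0 => e2.
rewrite /C [leRHS]mulrDl [leLHS]mulrDl lerD//; first by rewrite ler_wpM2l.
have -> : 4 * (d + s + 1) / m * expR (- (m / 2) * t) =
  2 * (d + s + 1) * (2 / m * expR (- (m / 2) * t)) by field; rewrite gt_eqF.
by rewrite -mulrA ler_wpM2l//; have := d0; have := s0; lra.
Qed.

Let integral_L psi : 0 <= psi <= pi / 2 -> (\int[mu]_(t in I) (L t psi)%:E = 0)%E.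
Proof.
move=> hp.
rewrite (_ : 0%E = (0 - 0 : R)%:E); last by rewrite subrr.
apply: (@integrable_FTC_half_line _ (L ^~ psi)
  (fun t => - (t * expR (- A t psi) * sin (B t psi + phi)))).
- apply: (@integrable_expR_dom _ _ C (m / 2)); first by rewrite divr_gt0.
  + by rewrite /L /A' /B' /A /B; mfun.
  + by move=> t t0; exact: L_le.
- by move=> t t0; exact: dL.
- by move=> t t0; rewrite /L /A' /B' /A /B; dercont.
- apply: (@cvg_at_right0_lin_dom _ _ 1) => t t0.
  rewrite normrN !normrM (ger0_norm (expR_ge0 _)) (ger0_norm (ltW t0)) mul1r.
  rewrite -mulrA -[leRHS]mulr1 ler_wpM2l ?(ltW t0)// -[leRHS]mulr1 ler_pM//.
    apply: le_trans (expA_le t0 hp) _.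
    rewrite -expR0 ler_expR mulNr oppr_le0 mulr_ge0// ltW//.
  by rewrite ler_norml sin_geN1 sin_le1.
- apply: (@cvg_pinfty_expR_dom _ _ (2 / m) (m / 2)); first by rewrite divr_gt0.
  move=> t t0; apply: le_trans (mul_expRN_le t m0).
  rewrite normrN !normrM (ger0_norm (expR_ge0 _)) (ger0_norm (ltW t0)).
  rewrite -mulrA ler_wpM2l ?(ltW t0)// -[leRHS]mulr1 ler_pM//; first exact: expA_le.
  by rewrite ler_norml sin_geN1 sin_le1.
Qed.

Let mK psi : measurable_fun I (K ^~ psi).
Proof. by rewrite /K /A /B; mfun. Qed.

Let integrable_K psi : 0 <= psi <= pi / 2 -> mu.-integrable I (EFin \o K ^~ psi).
Proof.
move=> hp; apply: (@integrable_expR_dom _ _ 1 m) => // t t0; exact: K_le.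
Qed.

(** The difference is the integral of [L] over the angle; after exchanging the integrals, each inner
    integral over t vanishes by [integral_L]. *)
Let integral_KB : (\int[mu]_(t in I) (K t (pi / 2) - K t 0)%:E = 0)%E.
Proof.
have p0 : 0 < pi / 2 :> R by rewrite divr_gt0// pi_gt0.
transitivity (\int[mu]_(t in I) \int[mu]_(psi in `[0%R, (pi / 2)%R]) (L t psi)%:E)%E.
  apply: eq_integral => t; rewrite inE/= in_itv/= andbT => t0.
  rewrite (@FTC_segment _ (L t) (K t))//.
  by move=> psi; rewrite /L /A' /B' /A /B; dercont.
rewrite (@fubini_dominated _ _ (measurableTypeR R) (measurableTypeR R) R mu mu I `[0%R, (pi / 2)%R]
  (measurable_itv _) (measurable_itv _) _ L (fun t => C * expR (- (m / 2) * t))) //.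
- by rewrite integral0_eq// => psi; rewrite /= in_itv/=; exact: integral_L.
- by rewrite [X in (X < _)%E]lebesgue_measure_itv/= lte_fin p0 sube0 ltry.
- by rewrite /L /A' /B' /A /B; mfun.
- rewrite (_ : EFin \o _ = (fun t => C%:E * (EFin \o (fun t => expR (- (m / 2) * t))) t)%E)//.
  by apply/integrableZl/integrable_expR_half_line => //; rewrite divr_gt0.
- move=> t psi; rewrite /= !in_itv/= andbT => t0 hp; exact: L_le.
Qed.

Lemma ray_rotation :
  (\int[mu]_(t in I) (expR (- (d * t + t `^ a * cos (pi * a / 2))) *
     cos (s * t + t `^ a * sin (pi * a / 2) + phi))%:E =
   \int[mu]_(t in I) (expR (- (s * t + t `^ a)) * cos (pi / 2 - d * t + phi))%:E)%E.
Proof.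
have p0 : 0 <= pi / 2 :> R by rewrite divr_ge0// pi_ge0.
transitivity (\int[mu]_(t in I) (K t 0)%:E)%E.
  apply: eq_integral => t _; congr EFin; rewrite /K /A /B cos0 sin0.
  have -> : a * (pi / 2 - 0) = pi * a / 2 by ring.
  by congr (expR (- _) * cos _); ring.
transitivity (\int[mu]_(t in I) (K t (pi / 2))%:E)%E; last first.
  apply: eq_integral => t _; congr EFin; rewrite /K /A /B cos_pihalf sin_pihalf.
  rewrite (_ : a * (pi / 2 - pi / 2) = 0); last by ring.
  rewrite cos0 sin0.
  by congr (expR (- _) * cos _); ring.
have hb0 : 0 <= (0 : R) <= pi / 2 by rewrite lexx p0.
have hb1 : 0 <= (pi / 2 : R) <= pi / 2 by rewrite lexx p0.
have h0 := integrable_K hb0; have h1 := integrable_K hb1.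
have mI : measurable (I : set (measurableTypeR R)) by exact: measurable_itv.
have f0 := integrable_fin_num mI h0; have f1 := integrable_fin_num mI h1.
move: integral_KB; rewrite integralB_EFin//.
by rewrite -(fineK f0) -(fineK f1) -EFinB => -[] /subr0_eq ->.
Qed.

End ray_rotation.

(** * The stable law *)

Section laplace_of_charfun.
Context {R : realType}.
Local Notation mu := (@lebesgue_measure R).
Local Notation I := (`]0, +oo[%classic : set R).

Lemma norm_sin_le (x : R) : 0 < x -> `|sin x| <= x.
Proof.
move=> x0.
have h1 y : y \in `]0, x[%R -> is_derive y 1 sin (cos y) by move=> _; exact: is_derive_sin.
have h2 : {within `[0, x], continuous (@sin R)}.
  by apply: continuous_subspaceT => y; exact: continuous_sin.
have [c _] := MVT x0 h1 h2.
rewrite sin0 !subr0 => ->; rewrite normrM (gtr0_norm x0) -[leRHS]mul1r.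
by rewrite ler_wpM2r ?(ltW x0)// ler_norml cos_geN1 cos_le1.
Qed.

(** The right-hand side is the real part of e^(i phi) / (d - i y): the phase 0 gives d / (d^2 + y^2)
    and the phase - pi / 2 gives y / (d^2 + y^2). *)
Lemma integral_expR_cos (d y phi : R) : 0 < d ->
  (\int[mu]_(t in I) (expR (- d * t) * cos (t * y + phi))%:E =
   ((d * cos phi - y * sin phi) / (d ^+ 2 + y ^+ 2))%:E)%E.
Proof.
move=> d0.
have e0 : d ^+ 2 + y ^+ 2 != 0 by rewrite gt_eqF// ltr_wpDr ?sqr_ge0// exprn_gt0.
pose F t := expR (- d * t) * (y * sin (t * y + phi) - d * cos (t * y + phi)) / (d ^+ 2 + y ^+ 2).
rewrite (_ : (d * cos phi - y * sin phi) / (d ^+ 2 + y ^+ 2) = 0 - F 0); last first.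
  by rewrite /F mulr0 expR0 !mul0r !add0r mul1r; field; exact: e0.
have nc x : `|cos x| <= 1 :> R by rewrite ler_norml cos_geN1 cos_le1.
have ns x : `|sin x| <= 1 :> R by rewrite ler_norml sin_geN1 sin_le1.
apply: (@integrable_FTC_half_line _ (fun t => expR (- d * t) * cos (t * y + phi)) F).
- apply: (@integrable_expR_dom _ _ 1 d) => //; first by mfun.
  by move=> t t0; rewrite normrM (ger0_norm (expR_ge0 _)) mulrC ler_pM.
- move=> t t0; rewrite /F; apply: has_deriv_eq; [by der|cbv beta].
  field; exact: e0.
- by move=> t t0; dercont.
- have c : {for (0 : R), continuous F} by rewrite /F; dercont.
  exact: (cvg_at_right_filter c).
- apply: (@cvg_pinfty_expR_dom _ _ ((`|y| + d) / (d ^+ 2 + y ^+ 2)) d) => // t t0.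
  have D0 : 0 < d ^+ 2 + y ^+ 2 by rewrite ltr_wpDr ?sqr_ge0// exprn_gt0.
  have hN : `|y * sin (t * y + phi) - d * cos (t * y + phi)| <= `|y| + d.
    apply: le_trans (ler_normB _ _) _; rewrite !normrM (ger0_norm (ltW d0)).
    by rewrite lerD// -[leRHS]mulr1 ler_wpM2l ?(ltW d0).
  rewrite /F normrM normrM (ger0_norm (expR_ge0 _)) normfV (gtr0_norm D0).
  rewrite [leRHS]mulrC mulrA ler_wpM2r ?invr_ge0 ?(ltW D0)//.
  by rewrite ler_wpM2l ?expR_ge0.
Qed.

Context {dT : measure_display} {T : measurableType dT} (P : probability T R).
Variables (a : R) (X : T -> R).
Hypotheses (ha : 0 < a <= 1) (mX : measurable_fun setT X).

Lemma bounded_integrable (f : T -> R) (M : R) : measurable_fun setT f ->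
  (forall w, `|f w| <= M) -> P.-integrable setT (EFin \o f).
Proof.
move=> mf fM; apply: (@le_integrable _ _ _ P setT _ _ (EFin \o cst M)) => //.
- exact/measurable_EFinP.
- by move=> w _ /=; rewrite lee_fin; apply: le_trans (fM w) _; exact: ler_norm.
- exact: finite_measure_integrable_cst.
Qed.

Hypothesis hX : stable_charfun P a X.

(** The addition formula turns the two real identities for the characteristic function into one for
    s + X with an arbitrary phase. *)
Let integral_cosD s t phi : 0 < t ->
  (\int[P]_w (cos (t * (s + X w) + phi))%:E =
   (expR (- (t `^ a * cos (pi * a / 2))) *
     cos (s * t + t `^ a * sin (pi * a / 2) + phi))%:E)%E.
Proof.
move=> t0; have [hc hs] := hX t.
have nc x : `|cos x| <= 1 :> R by rewrite ler_norml cos_geN1 cos_le1.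
have ns x : `|sin x| <= 1 :> R by rewrite ler_norml sin_geN1 sin_le1.
have ic : P.-integrable setT (fun w => (cos (t * X w))%:E).
  by apply: (@bounded_integrable (fun w => cos (t * X w)) 1) => //; mfun.
have is_ : P.-integrable setT (fun w => (sin (t * X w))%:E).
  by apply: (@bounded_integrable (fun w => sin (t * X w)) 1) => //; mfun.
transitivity (\int[P]_w ((cos (t * s + phi))%:E * (cos (t * X w))%:E -
    (sin (t * s + phi))%:E * (sin (t * X w))%:E))%E.
  apply: eq_integral => w _; rewrite -!EFinM -EFinB; congr EFin.
  by rewrite -cosD; congr cos; ring.
rewrite integralB//; [|exact: integrableZl..].
rewrite !integralZl// hc hs gtr0_norm// gtr0_sg// mul1r -!EFinM -EFinB; congr EFin.
rewrite (_ : s * t + _ + phi = (t * s + phi) + t `^ a * sin (pi * a / 2)); last by ring.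
by rewrite [in RHS]cosD; ring.
Qed.

(** On the left is the real part of e^(i phi) E[1 / (d - i (s + X))]. On the right d appears only
    inside a cosine, so the integral stays controlled as d tends to 0. *)
Lemma stable_resolvent (d s phi : R) : 0 < d -> 0 < s ->
  (\int[P]_w ((d * cos phi - (s + X w) * sin phi) / (d ^+ 2 + (s + X w) ^+ 2))%:E =
   \int[mu]_(t in I) (expR (- (s * t + t `^ a)) * cos (pi / 2 - d * t + phi))%:E)%E.
Proof.
move=> d0 s0; rewrite -ray_rotation//.
transitivity (\int[P]_w \int[mu]_(t in I) (expR (- d * t) * cos (t * (s + X w) + phi))%:E)%E.
  by apply: eq_integral => w _; rewrite integral_expR_cos.
rewrite -(@fubini_dominated _ _ (measurableTypeR R) T R mu P I setT _ _ _
  (fun t w => expR (- d * t) * cos (t * (s + X w) + phi)) (fun t => expR (- d * t)))//.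
- apply: eq_integral => t; rewrite inE/= in_itv/= andbT => t0.
  under eq_integral do rewrite EFinM.
  rewrite integralZl//; last first.
    apply: (@bounded_integrable (fun w => cos (t * (s + X w) + phi)) 1) => //; first by mfun.
    by move=> w; rewrite ler_norml cos_geN1 cos_le1.
  rewrite integral_cosD// -EFinM mulrA -expRD; congr (expR _ * _)%:E.
  by rewrite mulNr opprD.
- by rewrite [X in (X < _)%E]probability_setT ltry.
- by mfun.
- exact: integrable_expR_half_line.
- move=> t w _ _; rewrite normrM (ger0_norm (expR_ge0 _)) -[leRHS]mulr1.
  by rewrite ler_wpM2l ?expR_ge0// ler_norml cos_geN1 cos_le1.
Qed.

(** Phase 0. On the ball, d / (d^2 + y^2) >= 1 / (2 d), while the other side is an integral of e^(-s
    t - t^a) sin (d t), at most d times that of t e^(-s t), hence at most 4 d / s^2. The product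
    with 2 d gives the constant 8. *)
Let stable_ball_le s d : 0 < d -> 0 < s ->
  (P [set w | `|s + X w| <= d]%R <= (8 * d ^+ 2 / s ^+ 2)%:E)%E.
Proof.
move=> d0 s0.
have mB : measurable [set w | `|s + X w| <= d]%R.
  rewrite -[X in measurable X]setTI.
  have mn : measurable_fun setT (fun w => `|s + X w|).
    by apply: measurableT_comp => //; mfun.
  rewrite (_ : [set w | _] = (fun w => `|s + X w|) @^-1` `]-oo, d]%classic); last first.
    by apply/seteqP; split => w /=; rewrite in_itv.
  exact: mn.
have d2 y : 0 < d ^+ 2 + y ^+ 2 by rewrite ltr_wpDr ?sqr_ge0// exprn_gt0.
have h := @stable_resolvent d s 0 d0 s0; move: h; rewrite cos0 sin0.
have h1 : (((2 * d)^-1)%:E * P [set w | `|s + X w| <= d]%R <=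
    \int[P]_w ((d * 1 - (s + X w) * 0) / (d ^+ 2 + (s + X w) ^+ 2))%:E)%E.
  have -> : (((2 * d)^-1)%:E * P [set w | `|s + X w| <= d]%R =
    \int[P]_w ((2 * d)^-1 * \1_[set w | `|s + X w| <= d]%R w)%:E)%E.
    under eq_integral do rewrite EFinM.
    rewrite ge0_integralZl//.
    + by rewrite integral_indic// setIT.
    + exact/measurable_EFinP.
    + by rewrite lee_fin invr_ge0 mulr_ge0// ltW.
  apply: ge0_le_integral => //.
  + by move=> w _; rewrite lee_fin mulr_ge0// invr_ge0 mulr_ge0// ltW.
  + by apply/measurable_EFinP; apply: measurable_funM.
  + by mfun.
  + move=> w _; rewrite lee_fin mulr0 subr0 mulr1 indicE.
    have [hw|_] := boolP (w \in _); last by rewrite mulr0 divr_ge0 ?ltW.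
    rewrite mulr1 ler_pdivlMr// ler_pdivrMl; last by rewrite mulr_gt0.
    move: hw; rewrite inE/= => hw.
    have : (s + X w) ^+ 2 <= d ^+ 2.
      by rewrite -(real_normK (num_real (s + X w))) lerXn2r ?nnegrE// ltW.
    nra.
move=> h2; move: h1; rewrite h2.
have h3 : (\int[mu]_(t in I) (expR (- (s * t + t `^ a)) * cos (pi / 2 - d * t + 0))%:E <=
    \int[mu]_(t in I) ((2 * d / s) * expR (- (s / 2) * t))%:E)%E.
  apply: le_trans (lee_abs _) _.
  apply: le_trans (le_abse_integral _ _ _) _ => //; first by mfun.
  apply: ge0_le_integral => //.
  + by apply: measurableT_comp => //; mfun.
  + by mfun.
  + move=> t; rewrite /= in_itv/= andbT => t0; rewrite lee_fin addr0 -cosN opprB cosBpihalf.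
    rewrite normrM (ger0_norm (expR_ge0 _)).
    apply: (@le_trans _ _ (expR (- s * t) * (d * t))).
      apply: ler_pM => //; last by apply: norm_sin_le; rewrite mulr_gt0.
      by rewrite ler_expR mulNr lerN2 lerDl powR_ge0.
    rewrite (_ : expR (- s * t) * (d * t) = d * (t * expR (- s * t))); last by ring.
    rewrite (_ : 2 * d / s * _ = d * (2 / s * expR (- (s / 2) * t))); last by ring.
    by rewrite ler_wpM2l ?(ltW d0)// mul_expRN_le.
move=> h4; have {h4 h3} := le_trans h4 h3.
under eq_integral do rewrite EFinM.
rewrite ge0_integralZl//.
- rewrite integral_expR_half_line ?divr_gt0//.
  rewrite -EFinM -lee_pdivlMl ?invr_gt0 ?mulr_gt0//.
  move=> /le_trans; apply; rewrite -EFinM lee_fin invrK.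
  by rewrite le_eqVlt; apply/orP; left; apply/eqP; field; rewrite gt_eqF.
- by mfun.
- by rewrite lee_fin divr_ge0 ?mulr_ge0 ?ltW.
Qed.

(* The bound is quadratic in the length of the interval, so that n bisections gain
   a factor 2 ^ n. *)
Let stable_itv_le m p q n : 0 < m -> m <= p -> p < q ->
  (P (X @^-1` `[(- q)%R, (- p)%R]) <= (2 / m ^+ 2 * (q - p) ^+ 2 / 2 ^+ n)%:E)%E.
Proof.
move=> m0; elim: n p q => [|n ih] p q mp pq.
  have s0 : 0 < (p + q) / 2 by lra.
  have d0 : 0 < (q - p) / 2 by lra.
  have := stable_ball_le d0 s0.
  rewrite (_ : [set w | _] = X @^-1` `[- q, - p]%classic); last first.
    apply/seteqP; split => w /=; rewrite in_itv/= ler_norml => /andP[h1 h2];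
      apply/andP; split; lra.
  move=> /le_trans; apply; rewrite lee_fin expr0 divr1.
  have hm : (((p + q) / 2) ^+ 2)^-1 <= (m ^+ 2)^-1.
    rewrite lef_pV2 ?posrE ?exprn_gt0//; apply: lerXn2r; rewrite ?nnegrE; lra.
  have hqp : 0 <= 2 * (q - p) ^+ 2 by rewrite mulr_ge0 ?sqr_ge0.
  rewrite (_ : 8 * ((q - p) / 2) ^+ 2 / ((p + q) / 2) ^+ 2 =
    2 * (q - p) ^+ 2 * (((p + q) / 2) ^+ 2)^-1).
    by apply: le_trans (ler_wpM2l hqp hm) _; rewrite mulrAC.
  by congr (_ * _); field.
have mpre (A : set R) : measurable A -> measurable (X @^-1` A).
  by move=> mA; exact: measurable_preimage.
pose r := (p + q) / 2.
apply: (@le_trans _ _ (P (X @^-1` `[(- q)%R, (- r)%R] `|` X @^-1` `[(- r)%R, (- p)%R]))).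
  apply: le_measure; rewrite ?inE; [exact: mpre|by apply: measurableU; exact: mpre|].
  move=> w /=; rewrite !in_itv/= => /andP[h1 h2].
  by have [h|h] := leP (X w) (- r); [left|right]; apply/andP; split => //; exact: ltW.
apply: le_trans (measureU2 _ _ _) _; [exact: mpre..|].
have mr : m <= r by rewrite /r; lra.
have pr : p < r by rewrite /r; lra.
have rq : r < q by rewrite /r; lra.
apply: le_trans (leeD (ih r q mr rq) (ih p r mp pr)) _.
rewrite -EFinD lee_fin le_eqVlt; apply/orP; left; apply/eqP.
rewrite /r [2 ^+ n.+1]exprS [(2 * 2 ^+ n)^-1]invfM.
by move: ((2 ^+ n)^-1) => u; field; rewrite gt_eqF.
Qed.

Lemma stable_neg : P [set w | X w < 0]%R = 0%E.
Proof.
have mpre (A : set R) : measurable A -> measurable (X @^-1` A).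
  by move=> mA; exact: measurable_preimage.
rewrite (_ : [set w | _] = \bigcup_n (X @^-1` `[- n.+2%:R, - n.+2%:R^-1])); last first.
  apply/seteqP; split => w /=.
    move=> Xw0; have : `]0, +oo[%classic (- X w) by rewrite /= in_itv/= andbT oppr_gt0.
    rewrite -half_line_bigcup => -[n _]; rewrite /= in_itv/= => /andP[h1 h2].
    by exists n => //=; rewrite in_itv/= lerNl h2 lerNr.
  move=> [n _]; rewrite /= in_itv/= => /andP[_ h].
  by apply: le_lt_trans h _; rewrite oppr_lt0 invr_gt0.
apply: measure_negligible; first by apply: bigcup_measurable => n _; exact: mpre.
apply: negligible_bigcup => n; apply/negligibleP; first exact: mpre.
set A := X @^-1` _; have fA : P A \is a fin_num by apply: fin_num_measure; exact: mpre.
have m0 : 0 < (n.+2%:R : R)^-1 by rewrite invr_gt0.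
have h12 : (n.+2%:R : R)^-1 < n.+2%:R.
  by apply: (@lt_trans _ _ 1); rewrite ?ltr1n// invf_lt1// ltr1n.
pose K : R := 2 / n.+2%:R^-1 ^+ 2 * (n.+2%:R - n.+2%:R^-1) ^+ 2.
(* The segment is fixed and the number of bisections arbitrary, so its probability lies below a
   geometric sequence tending to 0. *)
have hA k : (P A <= (K / 2 ^+ k)%:E)%E by exact: stable_itv_le.
suff : P A = 0%E by [].
apply/eqP; rewrite eq_le measure_ge0 andbT -[X in (X <= _)%E](fineK fA) lee_fin.
have c0 : K / 2 ^+ k @[k --> \oo] --> (0 : R).
  have /(_ (ltac:(by rewrite ger0_norm// invf_lt1// ltr1n))) := @cvg_geometric R K 2^-1.
  rewrite (_ : geometric K 2^-1 = (fun k => K / 2 ^+ k))//.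
  by apply/funext => k; rewrite -exprVn.
rewrite -(cvg_lim _ c0)//; apply: limr_ge; first exact: cvgP c0.
by apply: nearW => k; rewrite -lee_fin fineK.
Qed.

End laplace_of_charfun.

(** * Positivity and moments of the stable law *)

Section stable_moments.
Context {R : realType}.
Local Notation mu := (@lebesgue_measure R).
Local Notation I := (`]0, +oo[%classic : set R).
Variable a : R.
Hypothesis ha : 0 < a <= 1.

Let a0 : 0 < a. Proof. by case/andP: ha. Qed.

Let mI : measurable (I : set (measurableTypeR R)).
Proof. exact: measurable_itv. Qed.

(** The Weibull density, which is minus the derivative of e^(-t^a). *)
Let weibull (t : R) := a * t `^ (a - 1) * expR (- t `^ a).

Let weibull_ge0 t : 0 <= weibull t.
Proof. by rewrite !mulr_ge0 ?powR_ge0 ?expR_ge0 ?(ltW a0). Qed.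

Lemma powR_cvg_pinfty : t `^ a @[t --> +oo] --> +oo.
Proof.
apply/cvgryPge => A; near=> t.
have t1 : Num.max A 1 `^ a^-1 <= t by near: t; exact: nbhs_pinfty_ge.
apply: (@le_trans _ _ (Num.max A 1)); first by rewrite le_max lexx.
have m0 : 0 <= Num.max A 1 by rewrite le_max ler01 orbT.
rewrite -[leLHS](powRr1 m0) -(@mulVf _ a) ?gt_eqF// powRrM.
apply: ge0_ler_powR => //; rewrite ?nnegrE ?powR_ge0 ?(ltW a0)//.
Unshelve. all: end_near. Qed.

(** The integrand is the derivative of - e^(-(s t + t^a)). At s = 0 this says that the Weibull
    density has mass one; for s > 0 it amounts to an integration by parts. *)
Let integral_weibullD s : 0 <= s ->
  (\int[mu]_(t in I) ((s + a * t `^ (a - 1)) * expR (- (s * t + t `^ a)))%:E = 1)%E.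
Proof.
move=> s0; rewrite (_ : 1%E = (0 - (- 1) : R)%:E); last by rewrite sub0r opprK.
apply: (@ge0_FTC_half_line _ (fun t => (s + a * t `^ (a - 1)) * expR (- (s * t + t `^ a)))
  (fun t => - expR (- (s * t + t `^ a)))).
- by move=> t t0; rewrite mulr_ge0 ?expR_ge0// addr_ge0// mulr_ge0 ?powR_ge0 ?(ltW a0).
- by move=> t t0; apply: has_deriv_eq; [by der|cbv beta; ring].
- by move=> t t0; dercont.
- apply: cvgN; rewrite -expR0.
  have c : s * t + t `^ a @[t --> 0^'+] --> (0 : R).
    suff : s * t + t `^ a @[t --> 0^'+] --> s * 0 + 0 by rewrite mulr0 addr0.
    apply: cvgD; last exact: powR_cvg0.
    by apply: cvgMr; exact: cvg_at_right_filter.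
  have c' : - (s * t + t `^ a) @[t --> 0^'+] --> (0 : R).
    by rewrite -[X in _ --> X]oppr0; exact: cvgN c.
  suff : expR (- (s * t + t `^ a)) @[t --> 0^'+] --> expR 0 by [].
  by apply: continuous_cvg c'; exact: continuous_expR.
- rewrite -[X in _ --> X]oppr0; apply: cvgN.
  apply: (@squeeze_cvgr _ _ _ _ (fun=> 0) (fun t => expR (- t `^ a))).
  + near=> t; rewrite expR_ge0 ler_expR lerN2 lerDr mulr_ge0//.
  + exact: cvg_cst.
  + exact: (cvg_comp _ _ powR_cvg_pinfty (@cvgr_expR R)).
Unshelve. all: end_near. Qed.

Let integral_weibull : (\int[mu]_(t in I) (weibull t)%:E = 1)%E.
Proof.
rewrite -(integral_weibullD (lexx 0)); apply: eq_integral => t _.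
by rewrite add0r mul0r add0r.
Qed.

Let integrable_weibull : mu.-integrable I (EFin \o weibull).
Proof.
apply/integrableP; split; first by apply/measurable_EFinP; rewrite /weibull; mfun.
under eq_integral do rewrite /= ger0_norm//.
by rewrite integral_weibull ltry.
Qed.

Let integral_expR_weibull s : 0 < s ->
  (\int[mu]_(t in I) (expR (- s * t) * weibull t)%:E +
   s%:E * \int[mu]_(t in I) (expR (- (s * t + t `^ a)))%:E = 1)%E.
Proof.
move=> s0; rewrite -(integral_weibullD (ltW s0)).
rewrite -ge0_integralZl//; last 2 first.
- by mfun.
- by rewrite lee_fin ltW.
rewrite -ge0_integralD//.
- apply: eq_integral => t _; rewrite -EFinM -EFinD; congr EFin.
  by rewrite /weibull opprD expRD mulNr; ring.
- by move=> t _; rewrite lee_fin mulr_ge0 ?expR_ge0.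
- by rewrite /weibull; mfun.
- by move=> t _; rewrite mule_ge0 ?lee_fin ?expR_ge0 ?(ltW s0).
- by apply: measurable_funeM; mfun.
Qed.

Let cvg_harm : (n.+1%:R : R)^-1 @[n --> \oo] --> (0 : R).
Proof. exact: cvg_harmonic. Qed.

Let cvg_integral_expR_weibull :
  (\int[mu]_(t in I) (expR (- n.+1%:R^-1 * t) * weibull t)%:E @[n --> \oo] --> 1)%E.
Proof.
rewrite -integral_weibull.
have [|||||_ _] := @dominated_convergence _ (measurableTypeR R) R mu I mI
  (fun n t => (expR (- n.+1%:R^-1 * t) * weibull t)%:E) (EFin \o weibull) (EFin \o weibull).
- by move=> n; rewrite /weibull; mfun.
- by apply/measurable_EFinP; rewrite /weibull; mfun.
- apply: aeW => t _; apply: cvg_EFin; first exact: nearW.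
  rewrite -[X in _ --> X]mul1r; apply: cvgMl.
  have c : - n.+1%:R^-1 * t @[n --> \oo] --> (0 : R).
    suff : - n.+1%:R^-1 * t @[n --> \oo] --> - 0 * t by rewrite oppr0 mul0r.
    by apply: cvgMl; apply: cvgN; exact: cvg_harm.
  suff : expR (- n.+1%:R^-1 * t) @[n --> \oo] --> expR 0 by rewrite expR0.
  by apply: continuous_cvg c; exact: continuous_expR.
- exact: integrable_weibull.
- apply: aeW => t n; rewrite /= in_itv/= andbT => t0.
  rewrite lee_fin normrM (ger0_norm (weibull_ge0 _)) (ger0_norm (expR_ge0 _)).
  rewrite -[leRHS]mul1r ler_wpM2r// -expR0 ler_expR mulNr oppr_le0.
  by rewrite mulr_ge0 ?invr_ge0 ?(ltW t0).
by [].
Qed.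

(** One term of the exponential series: (x t)^k / k! <= e^(x t). Together with [Mbound] it provides
    the same bound x^(-k) on both sides of the moment formula, as needed to differentiate under the
    integrals. *)
Let Vbound k (x t : R) : 0 < x -> 0 < t -> t ^+ k / k`!%:R * expR (- x * t) <= (x ^+ k)^-1.
Proof.
move=> x0 t0; have xk : 0 < x ^+ k by rewrite exprn_gt0.
rewrite mulNr expRN ler_pdivrMr ?expR_gt0// ler_pdivlMl//.
rewrite mulrA -exprMn.
case: k {xk} => [|k]; first by rewrite expr0 fact0 divr1 -expR0 ler_expR mulr_ge0 ?ltW.
apply: le_trans (expR_ge1Dxn k _); first by rewrite lerDr.
by rewrite mulr_ge0 ?ltW.
Qed.

Let Mbound k (x y : R) : 0 < x -> 0 < y -> 0 <= y / (x + y) ^+ k.+1 <= (x ^+ k)^-1.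
Proof.
move=> x0 y0; have xy : 0 < x + y by rewrite addr_gt0.
rewrite divr_ge0 ?exprn_ge0 ?(ltW y0) ?(ltW xy)//=.
rewrite exprS invfM mulrA -[leRHS]mul1r ler_pM ?divr_ge0 ?invr_ge0 ?exprn_ge0 ?(ltW y0) ?(ltW xy)//.
  by rewrite ler_pdivrMr// mul1r lerDr ltW.
by rewrite lef_pV2 ?posrE ?exprn_gt0// lerXn2r ?nnegrE ?(ltW x0) ?(ltW xy)// lerDl ltW.
Qed.

(** Functions that agree on the positive axis have the same derivative at s. It is phrased with
    difference quotients because differentiation under the integral delivers its limit in that
    form. *)
Lemma eq_difference_quotient_lim (f g : R -> R) (s lf lg : R) : 0 < s ->
  (forall x, 0 < x -> f x = g x) ->
  h^-1 *: (f (h + s) - f s) @[h --> 0^'] --> lf ->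
  h^-1 *: (g (h + s) - g s) @[h --> 0^'] --> lg -> lf = lg.
Proof.
move=> s0 fg hf hg; apply: (cvg_unique (@norm_hausdorff _ R) hf).
apply: (cvg_trans _ hg); apply: near_eq_cvg; near=> h.
have hs : `|h| < s by near: h; exact: dnbhs0_lt.
by rewrite !fg//; have := ler_norm (- h); rewrite normrN; lra.
Unshelve. all: end_near. Qed.

Context {dT : measure_display} {T : measurableType dT} (P : probability T R).
Variable X : T -> R.
Hypotheses (mX : measurable_fun setT X) (hX : stable_charfun P a X).

Let mpre (A : set R) : measurable A -> measurable (X @^-1` A).
Proof. by move=> mA; exact: measurable_preimage. Qed.

(** [D] already has probability one by [stable_neg]. That [B] does too is proved only in
    [stable_le0]: an atom of X at 0 has yet to be excluded. *)
Let D : set T := X @^-1` `[0, +oo[.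
Let B : set T := X @^-1` I.
Let mD : measurable D. Proof. exact: mpre. Qed.
Let mB : measurable B. Proof. exact: mpre. Qed.
Let DE w : D w -> 0 <= X w. Proof. by rewrite /D /= in_itv/= andbT. Qed.
Let BE w : B w -> 0 < X w. Proof. by rewrite /B /= in_itv/= andbT. Qed.

Let DC : D = setT `\` [set w | X w < 0].
Proof.
apply/seteqP; split => w; first by move=> /DE h; split => //=; apply/negP; rewrite -leNgt.
by move=> [_ /negP]; rewrite -leNgt /D /= in_itv/= andbT.
Qed.

Let mN : measurable [set w | X w < 0].
Proof.
rewrite (_ : [set w | _] = X @^-1` `]-oo, 0[%classic); first exact: mpre.
by apply/seteqP; split => w /=; rewrite in_itv.
Qed.

Let PD : P D = 1%E.
Proof.
rewrite DC setTD probability_setC// (stable_neg ha mX hX) sube0//.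
Qed.

(** Phase - pi / 2 and d = 1 / (n + 1) -> 0 in the resolvent identity. The bound y / (d^2 + y^2) <=
    1 / s for y = s + X needs X >= 0, hence the restriction to [D]. *)
Let stieltjes s : 0 < s ->
  (\int[P]_(w in D) ((s + X w)^-1)%:E =
   \int[mu]_(t in I) (expR (- (s * t + t `^ a)))%:E)%E.
Proof.
move=> s0.
pose f n w := (s + X w) / (n.+1%:R^-1 ^+ 2 + (s + X w) ^+ 2).
pose g n t := expR (- (s * t + t `^ a)) * cos (n.+1%:R^-1 * t).
have d0 n : 0 < (n.+1%:R : R)^-1 by rewrite invr_gt0.
have fgn n : (\int[P]_(w in D) (f n w)%:E = \int[mu]_(t in I) (g n t)%:E)%E.
  have := stable_resolvent ha mX hX (- (pi / 2)) (d0 n) s0.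
  rewrite cosN sinN cos_pihalf sin_pihalf => h.
  transitivity (\int[P]_w (f n w)%:E)%E.
    rewrite DC -negligible_integral//; last exact: (stable_neg ha mX hX).
    (* For d = 1 / (n + 1) the bound is 1 / (2 d), from (d - |y|)^2 >= 0; it holds for y of any
       sign. *)
    apply: (@bounded_integrable _ _ _ P (f n) (n.+1%:R / 2)); first by rewrite /f; mfun.
    move=> w; rewrite /f; set y := s + X w; set d := n.+1%:R^-1.
    have dd : n.+1%:R = d^-1 by rewrite invrK.
    have dp : 0 < d := d0 n.
    have e0 : 0 < d ^+ 2 + y ^+ 2 by rewrite ltr_wpDr ?sqr_ge0// exprn_gt0.
    rewrite normrM normfV (gtr0_norm e0) ler_pdivrMr// dd.
    rewrite mulrAC -mulrA ler_pdivlMl// ler_pdivlMr//.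
    have := sqr_ge0 (d - `|y|); have := real_normK (num_real y); nra.
  transitivity (\int[P]_w ((n.+1%:R^-1 * 0 - (s + X w) * -1) /
      (n.+1%:R^-1 ^+ 2 + (s + X w) ^+ 2))%:E)%E.
    by apply: eq_integral => w _; rewrite /f; congr (_ / _)%:E; ring.
  rewrite h; apply: eq_integral => t _; congr (_ * _)%:E.
  by rewrite -cosN; congr cos; ring.
have cf : (\int[P]_(w in D) (f n w)%:E @[n --> \oo] --> \int[P]_(w in D) ((s + X w)^-1)%:E)%E.
  have [|||||_ _] := @dominated_convergence _ T R P D mD
    (fun n w => (f n w)%:E) (fun w => ((s + X w)^-1)%:E) (EFin \o cst s^-1).
  - by move=> n; rewrite /f; mfun.
  - by mfun.
  - apply: aeW => w /DE Xw; apply: cvg_EFin; first exact: nearW.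
    have y0 : 0 < s + X w by rewrite ltr_wpDr.
    rewrite (_ : (s + X w)^-1 = (s + X w) / (0 ^+ 2 + (s + X w) ^+ 2)); last first.
      by rewrite expr0n/= add0r; field; rewrite gt_eqF.
    apply: cvgM; first exact: cvg_cst.
    apply: cvgV; first by rewrite expr0n/= add0r expf_neq0// gt_eqF.
    apply: cvgD; last exact: cvg_cst.
    by rewrite !expr2; apply: cvgM; exact: cvg_harm.
  - exact: finite_measure_integrable_cst.
  - apply: aeW => w n /DE Xw; rewrite lee_fin /f.
    have y0 : 0 < s + X w by rewrite ltr_wpDr.
    have e0 : 0 < n.+1%:R^-1 ^+ 2 + (s + X w) ^+ 2 by rewrite ltr_wpDr ?sqr_ge0// exprn_gt0.
    rewrite ger0_norm ?divr_ge0 ?(ltW y0) ?(ltW e0)//.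
    rewrite ler_pdivrMr// ler_pdivlMl//.
    have h1 : s * (s + X w) <= (s + X w) ^+ 2 by rewrite expr2 ler_wpM2r ?(ltW y0)// lerDl.
    by apply: le_trans h1 _; rewrite lerDr sqr_ge0.
  by [].
have cg : (\int[mu]_(t in I) (g n t)%:E @[n --> \oo] -->
    \int[mu]_(t in I) (expR (- (s * t + t `^ a)))%:E)%E.
  have [|||||_ _] := @dominated_convergence _ (measurableTypeR R) R mu I mI
    (fun n t => (g n t)%:E) (fun t => (expR (- (s * t + t `^ a)))%:E)
    (EFin \o (fun t => expR (- s * t))).
  - by move=> n; rewrite /g; mfun.
  - by mfun.
  - apply: aeW => t _; apply: cvg_EFin; first exact: nearW.
    rewrite -[X in _ --> X]mulr1; apply: cvgMr.
    have c : n.+1%:R^-1 * t @[n --> \oo] --> (0 : R).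
      suff : n.+1%:R^-1 * t @[n --> \oo] --> 0 * t by rewrite mul0r.
      by apply: cvgMl; exact: cvg_harm.
    suff : cos (n.+1%:R^-1 * t) @[n --> \oo] --> cos 0 by rewrite cos0.
    by apply: continuous_cvg c; exact: continuous_cos.
  - exact: integrable_expR_half_line.
  - apply: aeW => t n _; rewrite lee_fin /g normrM (ger0_norm (expR_ge0 _)) -[leRHS]mulr1.
    apply: ler_pM; rewrite ?expR_ge0//.
      by rewrite ler_expR mulNr lerN2 lerDl powR_ge0.
    by rewrite ler_norml cos_geN1 cos_le1.
  by [].
rewrite -(cvg_lim _ cf)//; under eq_fun do rewrite fgn.
exact: cvg_lim cg.
Qed.

(** X / (s + X) and s / (s + X) add up to 1 on [D], just as the two integrals of
    [integral_expR_weibull] do, and the second terms agree by [stieltjes]. Passing from [D] to [B]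
    costs nothing, as the integrand vanishes where X = 0. *)
Let moment0 s : 0 < s ->
  (\int[P]_(w in B) (X w / (s + X w))%:E =
   \int[mu]_(t in I) (expR (- s * t) * weibull t)%:E)%E.
Proof.
move=> s0.
have -> : (\int[P]_(w in B) (X w / (s + X w))%:E = \int[P]_(w in D) (X w / (s + X w))%:E)%E.
  rewrite integral_mkcond [RHS]integral_mkcond; apply: eq_integral => w _.
  rewrite !patchE; have [wB|wB] := boolP (w \in B).
    by rewrite mem_set// /D /= in_itv/= andbT ltW//; apply: BE; rewrite -inE.
  case: ifPn => // wD; have h0 : X w = 0.
    apply/eqP; rewrite eq_le DE ?andbT; last by rewrite -inE.
    by rewrite leNgt; apply: contra wB => h; rewrite inE /B /= in_itv/= andbT.
  by rewrite h0 mul0r.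
have e1 : (\int[P]_(w in D) (X w / (s + X w))%:E +
    s%:E * \int[P]_(w in D) ((s + X w)^-1)%:E = 1)%E.
  have p w : D w -> 0 < s + X w by move=> /DE h; rewrite ltr_wpDr.
  rewrite -ge0_integralZl//; last 3 first.
  - by mfun.
  - by move=> w /p h; rewrite lee_fin invr_ge0 ltW.
  - by rewrite lee_fin ltW.
  rewrite -ge0_integralD//.
  - transitivity (\int[P]_(w in D) cst 1 w)%E.
      apply: eq_integral => w; rewrite inE => /p h; rewrite -EFinM -EFinD; congr EFin.
      by field; rewrite gt_eqF.
    by rewrite integral_cst// mul1e; exact: PD.
  - by move=> w Dw; rewrite lee_fin divr_ge0 ?DE// ltW// p.
  - by mfun.
  - by move=> w /p h; rewrite mule_ge0 ?lee_fin ?invr_ge0 ?(ltW h) ?(ltW s0).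
  - by apply: measurable_funeM; mfun.
have e2 := integral_expR_weibull s0; move: e1; rewrite stieltjes// -e2.
set J := (s%:E * _)%E => e1.
(* Cancelling [J] from both sums in the extended reals requires that it be finite. *)
have fJ : J \is a fin_num.
  rewrite ge0_fin_numE; last first.
    rewrite mule_ge0 ?lee_fin ?(ltW s0)//; apply: integral_ge0 => t _.
    by rewrite lee_fin expR_ge0.
  apply: (@le_lt_trans _ _ 1%E); last exact: ltry.
  rewrite -e2 leeDr//; apply: integral_ge0 => t _.
  by rewrite lee_fin mulr_ge0 ?expR_ge0.
by rewrite -[LHS](addeK _ fJ) e1 (addeK _ fJ).
Qed.

(** Since X / (s + X) <= 1 on [B], [P B] is at least the integral in [moment0], which tends to the
    Weibull mass 1 as s -> 0. *)
Lemma stable_le0 : P (~` B) = 0%E.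
Proof.
rewrite probability_setC//.
suff -> : P B = 1%E by rewrite subee.
apply/eqP; rewrite eq_le probability_le1//=.
rewrite -(cvg_lim _ cvg_integral_expR_weibull)//.
apply: lime_le; first exact: cvgP cvg_integral_expR_weibull.
apply: nearW => n; have d0 : 0 < (n.+1%:R : R)^-1 by rewrite invr_gt0.
rewrite -moment0//.
apply: (@le_trans _ _ (\int[P]_(w in B) cst 1 w)%E); last by rewrite integral_cst// mul1e.
apply: ge0_le_integral => //.
- by move=> w /BE h; rewrite lee_fin divr_ge0 ?(ltW h)// addr_ge0 ?(ltW h) ?(ltW d0).
- by mfun.
- move=> w /BE h; rewrite lee_fin ler_pdivrMr ?addr_gt0// mul1r lerDr ltW//.
Qed.

(** [f] and [g] below obey the same recursion: the derivative in s of the k-th function is - (k + 1)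
    times the next one. The division by k! in [g] is there for this. *)
Let f k s w := X w / (s + X w) ^+ k.+1.
Let g k s t := t ^+ k / k`!%:R * expR (- s * t) * weibull t.

Let integrable_f k s : 0 < s -> P.-integrable B (EFin \o f k s).
Proof.
move=> s0; apply: (@le_integrable _ _ _ P B _ _ (EFin \o cst (s ^+ k)^-1)) => //.
- by apply/measurable_EFinP; rewrite /f; mfun.
- move=> w /BE h; rewrite lee_fin; have /andP[h1 h2] := Mbound k s0 h.
  by rewrite ger0_norm// (le_trans h2)// ler_norm.
- exact: finite_measure_integrable_cst.
Qed.

Let integrable_cst_weibull c : mu.-integrable I (EFin \o (fun t => c * weibull t)).
Proof.
rewrite (_ : EFin \o _ = (fun t => c%:E * (EFin \o weibull) t)%E)//.
exact: integrableZl.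
Qed.

Let g_ge0 k s t : 0 < t -> 0 <= g k s t.
Proof. by move=> t0; rewrite mulr_ge0// mulr_ge0 ?expR_ge0// divr_ge0 ?exprn_ge0 ?(ltW t0). Qed.

Let g_le k s t : 0 < s -> 0 < t -> g k s t <= (s ^+ k)^-1 * weibull t.
Proof. by move=> s0 t0; rewrite ler_wpM2r// Vbound. Qed.

Let integrable_g k s : 0 < s -> mu.-integrable I (EFin \o g k s).
Proof.
move=> s0.
apply: (@le_integrable _ _ _ mu I _ _ (EFin \o (fun t => (s ^+ k)^-1 * weibull t))) => //.
- by apply/measurable_EFinP; rewrite /g /weibull; mfun.
- move=> t; rewrite /= in_itv/= andbT => t0; rewrite lee_fin.
  by rewrite ger0_norm ?g_ge0// (le_trans (g_le k s0 t0))// ler_norm.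
Qed.

Let df k x w : 0 < x -> B w -> has_deriv (fun s => f k s w) (- k.+1%:R * f k.+1 x w) x.
Proof.
move=> x0 /BE h; have xy : x + X w != 0 by rewrite gt_eqF// addr_gt0.
rewrite /f; apply: has_deriv_eq; [by der; rewrite expf_neq0|cbv beta].
rewrite !exprS; have pk : (x + X w) ^+ k != 0 by rewrite expf_neq0.
by rewrite /=; move: ((x + X w) ^+ k) pk => p pk; field; rewrite pk xy.
Qed.

Let dg k x t : has_deriv (fun s => g k s t) (- k.+1%:R * g k.+1 x t) x.
Proof.
rewrite /g; apply: has_deriv_eq; [by der|cbv beta].
rewrite factS natrM exprS; have k0 : (k`!%:R : R) != 0 by rewrite pnatr_eq0 -lt0n fact_gt0.
have k1 : (k.+1%:R : R) != 0 by rewrite pnatr_eq0.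
by move: k0 k1; move: (k`!%:R) (k.+1%:R) => u v k0 k1; field; rewrite k0 k1.
Qed.

Let itvP (s x : R) : 0 < s -> `](s / 2), (s + 1)[%classic x -> s / 2 < x.
Proof. by move=> s0; rewrite /= in_itv/= => /andP[]. Qed.

Let pow_le k (s x : R) : 0 < s -> s / 2 < x -> (x ^+ k)^-1 <= ((s / 2) ^+ k)^-1.
Proof.
move=> s0 sx; have x0 : 0 < x by apply: lt_trans sx; rewrite divr_gt0.
rewrite lef_pV2 ?posrE ?exprn_gt0 ?divr_gt0//.
by rewrite lerXn2r ?nnegrE ?(ltW x0) ?(ltW sx)// divr_ge0 ?(ltW s0).
Qed.

(** Induction on k by differentiating the identity in s. Real-valued integrals are used because
    differentiation under the integral is a statement about them. *)
Let moment k s : 0 < s ->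
  (\int[P]_(w in B) f k s w = \int[mu]_(t in I) g k s t)%R.
Proof.
elim: k s => [|k ih] s s0.
  rewrite /Rintegral; congr fine.
  transitivity (\int[P]_(w in B) (X w / (s + X w))%:E)%E.
    by apply: eq_integral => w _; rewrite /f expr1.
  rewrite moment0//; apply: eq_integral => t _.
  by rewrite /g expr0 fact0 divr1 mul1r.
have s20 : 0 < s / 2 by rewrite divr_gt0.
have Is : `](s / 2), (s + 1)[%classic s by rewrite /= in_itv/=; apply/andP; split; lra.
have x0 x : `](s / 2), (s + 1)[%classic x -> 0 < x.
  by move=> /(itvP s0); apply: lt_trans.
(* Bounds the derivative in s uniformly on the window (s / 2, s + 1), which stays away from 0; on
   the Lebesgue side the dominating function is c times the Weibull density. *)
pose c := k.+1%:R * ((s / 2) ^+ k.+1)^-1.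
have c0 : 0 <= c by rewrite mulr_ge0// invr_ge0 exprn_ge0// ltW.
have hf : h^-1 *: (\int[P]_(w in B) f k (h + s) w - \int[P]_(w in B) f k s w)%R @[h --> 0^'] -->
    (- k.+1%:R * \int[P]_(w in B) f k.+1 s w)%R.
  rewrite -RintegralZl//; last exact: integrable_f.
  rewrite (_ : (\int[P]_(w in B) (- k.+1%:R * f k.+1 s w))%R =
      (\int[P]_(w in B) partial1of2 (f k) s w)%R); last first.
    apply: eq_Rintegral => w; rewrite inE => Bw.
    by rewrite partial1of2E; have [_ ->] := df k s0 Bw.
  apply: (@cvg_differentiation_under_integral R _ T P (f k) B mB s (s / 2) (s + 1) Is
    _ _ (cst c)) => //.
  - by move=> x /x0 ?; exact: integrable_f.
  - by move=> x w /x0 h1 Bw; case: (df k h1 Bw).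
  - exact: finite_measure_integrable_cst.
  - move=> x w Ix Bw; have h1 := x0 _ Ix.
    rewrite partial1of2E; have [_ ->] := df k h1 Bw.
    rewrite mulNr normrN normrM ger0_norm// ler_wpM2l//.
    have /andP[h2 h3] := Mbound k.+1 h1 (BE Bw).
    by rewrite ger0_norm// (le_trans h3)// pow_le// (itvP s0).
have hg : h^-1 *: (\int[mu]_(t in I) g k (h + s) t - \int[mu]_(t in I) g k s t)%R @[h --> 0^'] -->
    (- k.+1%:R * \int[mu]_(t in I) g k.+1 s t)%R.
  rewrite -RintegralZl//; last exact: integrable_g.
  rewrite (_ : (\int[mu]_(t in I) (- k.+1%:R * g k.+1 s t))%R =
      (\int[mu]_(t in I) partial1of2 (g k) s t)%R); last first.
    apply: eq_Rintegral => t _.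
    by rewrite partial1of2E; have [_ ->] := dg k s t.
  apply: (@cvg_differentiation_under_integral R _ (measurableTypeR R) mu (g k) I mI
    s (s / 2) (s + 1) Is _ _ (fun t => c * weibull t)) => //.
  - by move=> x /x0 ?; exact: integrable_g.
  - by move=> t; rewrite mulr_ge0.
  - move=> x t Ix; rewrite /= in_itv/= andbT => t0; have h1 := x0 _ Ix.
    rewrite partial1of2E; have [_ ->] := dg k x t.
    rewrite mulNr normrN normrM ger0_norm// /c -mulrA ler_wpM2l//.
    rewrite ger0_norm ?g_ge0// (le_trans (g_le _ h1 t0))// ler_wpM2r//.
    by rewrite pow_le// (itvP s0).
have := @eq_difference_quotient_lim (fun s => \int[P]_(w in B) f k s w)%R
  (fun s => \int[mu]_(t in I) g k s t)%R s _ _ s0 ih hf hg.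
have k0 : - (k.+1%:R : R) != 0 by rewrite oppr_eq0 pnatr_eq0.
exact: mulfI.
Qed.

(** The moment formula at s = 1 / q for q = z^(1/a), followed by the change of variable t -> q t.
    The factors q^k and q^(-k) cancel, and the Jacobian q combines with q^(a-1) into q^a = z. *)
Lemma stable_mixture k z : 0 < z ->
  (\int[P]_(w in B) (X w * z `^ a^-1 / (1 + X w * z `^ a^-1) ^+ k.+1)%:E =
   \int[mu]_(t in I) (t ^+ k / k`!%:R * expR (- t) *
     (a * t `^ (a - 1) * (z * expR (- z * t `^ a))))%:E)%E.
Proof.
move=> z0; set q := z `^ a^-1.
have q0 : 0 < q by rewrite powR_gt0.
have s0 : 0 < q^-1 by rewrite invr_gt0.
have qa : q `^ a = z by rewrite /q -powRrM mulVf ?gt_eqF// powRr1// ltW.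
have e : (\int[P]_(w in B) (f k q^-1 w)%:E = \int[mu]_(t in I) (g k q^-1 t)%:E)%E.
  rewrite -[LHS]fineK; last exact: (integrable_fin_num mB (integrable_f k s0)).
  rewrite -[RHS]fineK; last exact: (integrable_fin_num mI (integrable_g k s0)).
  by congr EFin; exact: moment.
transitivity ((q^-1 ^+ k)%:E * \int[P]_(w in B) (f k q^-1 w)%:E)%E.
  rewrite -ge0_integralZl//.
  - apply: eq_integral => w; rewrite inE => /BE h; rewrite -EFinM; congr EFin.
    rewrite /f (_ : q^-1 + X w = q^-1 * (1 + X w * q)); last by field; rewrite gt_eqF.
    have q1 : q != 0 by rewrite gt_eqF.
    rewrite exprMn [q^-1 ^+ k.+1]exprS.
    have pk : q^-1 ^+ k != 0 by rewrite expf_neq0// invr_eq0.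
    have pl : (1 + X w * q) ^+ k.+1 != 0 by rewrite expf_neq0// gt_eqF// addr_gt0// mulr_gt0.
    by move: (q^-1 ^+ k) ((1 + X w * q) ^+ k.+1) pk pl => u v pk pl; field; rewrite pk pl q1.
  - by rewrite /f; mfun.
  - by move=> w /BE h; rewrite lee_fin; case/andP: (Mbound k s0 h).
  - by rewrite lee_fin exprn_ge0// ltW.
rewrite e (integral_half_line_scale q0); last 2 first.
- by rewrite /g /weibull; mfun.
- by move=> t t0; rewrite lee_fin g_ge0.
rewrite muleA -EFinM -ge0_integralZl//.
- apply: eq_integral => t; rewrite inE/= in_itv/= andbT => t0; rewrite -EFinM; congr EFin.
  have q1 : q != 0 by rewrite gt_eqF.
  have e1 : - q^-1 * (q * t) = - t by field.
  have e2 : - (q * t) `^ a = - z * t `^ a by rewrite powRM ?(ltW q0) ?(ltW t0)// qa mulNr.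
  have e3 : (q * t) `^ (a - 1) = q `^ (a - 1) * t `^ (a - 1).
    by rewrite powRM ?(ltW q0) ?(ltW t0).
  have e4 : z = q * q `^ (a - 1) by rewrite mulr_powRB1// ltW.
  rewrite /g /weibull e1 e2 e3 exprMn exprVn.
  have pk : q ^+ k != 0 by rewrite expf_neq0.
  have k0 : (k`!%:R : R) != 0 by rewrite pnatr_eq0 -lt0n fact_gt0.
  move: (expR (- z * _)) => E; rewrite e4; move: (q ^+ k) (k`!%:R) pk k0 => u v pk k0.
  by field; rewrite pk k0.
- by rewrite /g /weibull; mfun.
- by move=> t; rewrite /= in_itv/= andbT => t0; rewrite lee_fin g_ge0// mulr_gt0.
- by rewrite lee_fin mulr_ge0 ?exprn_ge0 ?(ltW s0) ?(ltW q0).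
Qed.

End stable_moments.

(** * Independence and gamma ratios *)

Section independence.
Local Open Scope ereal_scope.
Context {R : realType}.

(** Rectangles are stable under intersection and generate the product sigma-algebra. *)
Lemma eq_measure_rectangles d1 d2 (T1 : measurableType d1) (T2 : measurableType d2)
    (m m' : {measure set (T1 * T2) -> \bar R}) :
  m setT < +oo ->
  (forall A B, measurable A -> measurable B -> m (A `*` B) = m' (A `*` B)) ->
  forall E, measurable E -> m E = m' E.
Proof.
move=> moo mm' E mE.
pose C : set (set (T1 * T2)) := [set A `*` B | A in measurable & B in measurable].
apply: (measure_unique C (fun=> setT)) => //.
- by rewrite measurable_prod_measurableType.
- move=> _ _ [A1 mA1 [B1 mB1 <-]] [A2 mA2 [B2 mB2 <-]].
  rewrite -setXI; exists (A1 `&` A2); first exact: measurableI.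
  by exists (B1 `&` B2) => //; exact: measurableI.
- by move=> n; exists setT => //; exists setT => //; rewrite setXTT.
- by rewrite bigcup_const.
- by move=> _ [A mA [B mB <-]]; exact: mm'.
Qed.

Context {d : measure_display} {T : measurableType d} (P : probability T R).

(** Independence identifies the law of (X, V) with the image of [P \x P] under (X, V) taken on
    separate coordinates. Using the sample space twice avoids naming the two marginal laws. *)
Lemma ge0_integral_indep d1 d2 (T1 : measurableType d1) (T2 : measurableType d2)
    (X : T -> T1) (V : T -> T2) (h : T1 * T2 -> \bar R) :
  measurable_fun setT X -> measurable_fun setT V ->
  (forall A B, measurable A -> measurable B ->
    P (X @^-1` A `&` V @^-1` B) = P (X @^-1` A) * P (V @^-1` B)) ->
  measurable_fun setT h -> (forall z, 0 <= h z) ->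
  \int[P]_w h (X w, V w) = \int[P]_v \int[P]_w h (X w, V v).
Proof.
move=> mX mV hXV mh h0.
pose phi w := (X w, V w).
pose psi (z : T * T) := (X z.1, V z.2).
have mphi : measurable_fun setT phi by exact: measurable_fun_pair.
have mpsi : measurable_fun setT psi.
  apply: measurable_fun_pair; [exact: (measurableT_comp mX)|exact: (measurableT_comp mV)].
transitivity (\int[pushforward P phi]_z h z).
  by rewrite ge0_integral_pushforward.
transitivity (\int[pushforward (P \x P) psi]_z h z); last first.
  rewrite ge0_integral_pushforward// preimage_setT.
  rewrite (fubini_tonelli2 (h \o psi))//; first exact: measurableT_comp.
  by move=> z; exact: h0.
apply: eq_measure_integral => E mE _.
apply: eq_measure_rectangles => //.
  change (P (phi @^-1` setT) < +oo).
  by rewrite preimage_setT probability_setT ltry.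
move=> A B mA mB.
change (P (X @^-1` A `&` V @^-1` B) = (P \x P) ((X @^-1` A) `*` (V @^-1` B))).
by rewrite hXV// product_measure1E//; exact: measurable_preimage.
Qed.

(** For fixed A both sides are finite measures in E: the law of the pair under P restricted to the
    event S in A, and a multiple of its law under P. They agree on rectangles by the triple product
    formula. *)
Lemma indep3_pair (S G1 G2 : T -> R) :
  measurable_fun setT S -> measurable_fun setT G1 -> measurable_fun setT G2 ->
  indep3 P S G1 G2 -> forall A E, measurable A -> measurable E ->
  P (S @^-1` A `&` (fun w => (G1 w, G2 w)) @^-1` E) =
  P (S @^-1` A) * P ((fun w => (G1 w, G2 w)) @^-1` E).
Proof.
move=> mS m1 m2 hind A E mA mE.
pose G w := (G1 w, G2 w).
have mG : measurable_fun setT G by exact: measurable_fun_pair.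
pose Gm : {mfun T >-> (R * R)%type} := HB.pack G (isMeasurableFun.Build _ _ _ _ _ mG).
have mSA := measurable_preimage mS mA.
have fA : P (S @^-1` A) \is a fin_num by exact: fin_num_measure.
pose k : {nonneg R} := NngNum (fine_ge0 (measure_ge0 P (S @^-1` A))).
have kE : (k%:num)%:E = P (S @^-1` A) by rewrite /= fineK.
transitivity (pushforward (mrestr P mSA) Gm E).
  by rewrite /pushforward /mrestr setIC.
transitivity (mscale k (distribution P Gm) E); last by rewrite /mscale /= kE.
apply: eq_measure_rectangles => //.
  change (P (G @^-1` setT `&` S @^-1` A) < +oo); rewrite preimage_setT setTI.
  by apply: (le_lt_trans (probability_le1 P mSA)); rewrite ltry.
move=> B C mB mC.
change (P (G @^-1` (B `*` C) `&` S @^-1` A) = (k%:num)%:E * P (G @^-1` (B `*` C))).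
rewrite kE.
have -> : P (G @^-1` (B `*` C)) = P (G1 @^-1` B) * P (G2 @^-1` C).
  have := hind setT B C measurableT mB mC.
  by rewrite preimage_setT setTI probability_setT mul1e.
rewrite muleA -hind//; congr (P _).
by apply/seteqP; split => w; [move=> [[/= ? ?] ?]|move=> [[/= ? ?] ?]].
Qed.

Lemma measurable_indic_ray d' (T' : measurableType d') (g h : T' -> R) :
  measurable_fun setT g -> measurable_fun setT h ->
  measurable_fun setT (fun z => \1_(`]-oo, g z[%classic : set R) (h z) : R).
Proof.
move=> mg mh.
rewrite (_ : (fun z => _) = \1_((fun z => g z - h z)%R @^-1` `]0%R, +oo[%classic)).
  apply: measurable_indic; rewrite -[X in measurable X]setTI.
  by apply: measurable_funB.
apply/funext => z; rewrite !indicE; congr (nat_of_bool _)%:R.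
by apply/idP/idP; rewrite !inE/= !in_itv/= ?andbT subr_gt0.
Qed.

(** The law of G is known only on sets, so f is written in layers, f(x) being the integral over t >
    0 of the indicator of t < f(x), and Tonelli is applied on both sides. *)
Lemma ge0_integral_density (G : T -> R) (p f : R -> R) :
  measurable_fun setT G -> measurable_fun setT p -> measurable_fun setT f ->
  (forall x, 0 < x -> 0 <= p x)%R -> (forall x, 0 <= f x)%R ->
  (forall A, measurable A -> P (G @^-1` A) =
     \int[@lebesgue_measure R]_(x in A `&` `[0%R, +oo[) (p x)%:E) ->
  \int[P]_w (f (G w))%:E =
  \int[@lebesgue_measure R]_(x in `]0%R, +oo[) (f x * p x)%:E.
Proof.
move=> mG mp mf p0 f0 hG.
pose I : set (measurableTypeR R) := `]0%R, +oo[%classic.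
have mI : measurable I by exact: measurable_itv.
have layer y : (0 <= y)%R ->
    \int[@lebesgue_measure R]_(t in I) (\1_(`]-oo, y[%classic : set R) t)%:E = y%:E.
  move=> y0.
  have my : measurable (`]-oo, y[%classic : set (measurableTypeR R)) by exact: measurable_itv.
  rewrite integral_indic//.
  rewrite (_ : _ `&` _ = `]0%R, y[%classic); last first.
    apply/seteqP; split => t /=; rewrite /I /= !in_itv/= ?andbT.
      by move=> [h1 h2]; rewrite h1 h2.
    by move=> /andP[h1 h2]; rewrite h1 h2.
  rewrite [LHS]lebesgue_measure_itv/= lte_fin; case: ltgtP y0 => // [_ _|<- _].
    by rewrite sube0.
  by [].
have ind t y : (\1_(`]-oo, y[%classic : set R) t = \1_(`]t, +oo[%classic : set R) y :> R)%R.
  rewrite !indicE; congr (nat_of_bool _)%:R; apply/idP/idP; rewrite !inE/= !in_itv/= ?andbT//.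
transitivity (\int[P]_w \int[@lebesgue_measure R]_(t in I)
    (\1_(`]-oo, f (G w)[%classic : set R) t)%:E).
  by apply: eq_integral => w _; rewrite layer.
rewrite (@tonelli_in _ _ T (measurableTypeR R) R P _ setT I _ _
  (fun w t => (\1_(`]-oo, f (G w)[%classic : set R) t)%:E))//; last first.
- apply/measurable_EFinP; apply: measurable_indic_ray; last exact: measurable_snd.
  exact: (measurableT_comp mf (measurableT_comp mG measurable_fst)).
transitivity (\int[@lebesgue_measure R]_(t in I) \int[@lebesgue_measure R]_(x in I)
    (\1_(`]-oo, f x[%classic : set R) t * p x)%:E).
  apply: eq_integral => t _.
  have mA : measurable (f @^-1` `]t, +oo[) by rewrite -[X in measurable X]setTI; exact: mf.
  transitivity (\int[P]_w (\1_(G @^-1` (f @^-1` `]t, +oo[)) w)%:E).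
    by apply: eq_integral => w _; rewrite ind !indicE.
  rewrite integral_indic ?setIT//; last exact: measurable_preimage.
  transitivity (\int[@lebesgue_measure R]_(x in
      f @^-1` `]t, +oo[%classic `&` `[0%R, +oo[) (p x)%:E).
    exact: (hG _ mA).
  rewrite setIC.
  rewrite integral_mkcondr -integral_itv_obnd_cbnd.
    apply: eq_integral => x _; rewrite patchE ind indicE.
    have -> : (x \in f @^-1` `]t, +oo[%classic) = (f x \in `]t, +oo[%classic) by [].
    by case: ifP => _; rewrite ?mul1r ?mul0r.
  apply/(measurable_restrict _ mA (measurable_itv _)).
  by apply: measurable_funTS; exact/measurable_EFinP.
rewrite (@tonelli_in _ _ (measurableTypeR R) (measurableTypeR R) R _ _ I I _ _
  (fun t x => (\1_(`]-oo, f x[%classic : set R) t * p x)%:E))//; last 2 first.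
- apply/measurable_EFinP; apply: measurable_funM.
    apply: measurable_indic_ray; last exact: measurable_fst.
    exact: (measurableT_comp mf measurable_snd).
  exact: (measurableT_comp mp measurable_snd).
- by move=> t x _; rewrite /I /= in_itv/= andbT => x0; rewrite lee_fin mulr_ge0 ?p0// indicE.
apply: eq_integral => x; rewrite inE /I /= in_itv/= andbT => x0.
under eq_integral do rewrite mulrC EFinM.
rewrite ge0_integralZl//.
- by rewrite layer// -EFinM mulrC.
- apply/measurable_EFinP/measurable_funTS.
  exact: measurable_indic.
- by rewrite lee_fin p0.
Qed.

End independence.

(** * The Laplace-type integral of the gamma ratio *)

Section gamma_ratio.
Context {R : realType}.
Local Notation leb := (@lebesgue_measure R).
Local Notation I := (`]0, +oo[%classic : set R).

Let mI : measurable (I : set (measurableTypeR R)).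
Proof. exact: measurable_itv. Qed.

Definition gamma_density (s x : R) : R := x `^ (s - 1) * expR (- x) / Gamma s.

Lemma Gamma_ge0 (s : R) : 0 <= Gamma s.
Proof.
rewrite /Gamma fine_ge0//; apply: integral_ge0 => x _.
by rewrite lee_fin mulr_ge0 ?powR_ge0 ?expR_ge0.
Qed.

Lemma gamma_density_ge0 (s x : R) : 0 <= gamma_density s x.
Proof. by rewrite divr_ge0 ?Gamma_ge0// mulr_ge0 ?powR_ge0 ?expR_ge0. Qed.

Lemma measurable_gamma_density (s : R) : measurable_fun setT (gamma_density s).
Proof. by rewrite /gamma_density; mfun. Qed.

(** [fine] sends an infinite integral to 0, so a nonzero value of [Gamma] certifies convergence. *)
Lemma Gamma_integral (s : R) : Gamma s != 0 ->
  (\int[leb]_(x in I) (x `^ (s - 1) * expR (- x))%:E = (Gamma s)%:E)%E.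
Proof.
have -> : (\int[leb]_(x in I) (x `^ (s - 1) * expR (- x))%:E =
    \int[leb]_(x in `[0%R, +oo[) (x `^ (s - 1) * expR (- x))%:E)%E.
  by rewrite integral_itv_obnd_cbnd//; mfun.
rewrite /Gamma; set J := (\int[_]_(x in _) _)%E.
have : (0 <= J)%E.
  by apply: integral_ge0 => x _; rewrite lee_fin mulr_ge0 ?powR_ge0 ?expR_ge0.
by case: J => //=; rewrite eqxx.
Qed.

Lemma Gamma1 : Gamma 1 = 1 :> R.
Proof.
rewrite /Gamma -integral_itv_obnd_cbnd; last by mfun.
transitivity (fine (\int[leb]_(x in I) (expR (- 1 * x))%:E)%E).
  by congr fine; apply: eq_integral => x _; rewrite subrr powRr0 mul1r mulN1r.
by rewrite integral_expR_half_line// invr1.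
Qed.

Context {d : measure_display} {T : measurableType d} (P : probability T R).

Lemma gamma_law_density (s : R) (G : T -> R) : 0 < s ->
  (forall A, measurable A -> P (G @^-1` A) = gamma_law s A) ->
  forall A, measurable A -> (P (G @^-1` A) =
    \int[leb]_(x in A `&` `[0%R, +oo[) (gamma_density s x)%:E)%E.
Proof. by move=> s0 hG A mA; rewrite hG// /gamma_law gt_eqF. Qed.

Lemma integral_gamma_density (s : R) (G : T -> R) : 0 < s ->
  (forall A, measurable A -> P (G @^-1` A) = gamma_law s A) ->
  (\int[leb]_(x in I) (gamma_density s x)%:E = 1)%E.
Proof.
move=> s0 hG; have := gamma_law_density s0 hG measurableT.
rewrite preimage_setT probability_setT setTI => ->.
apply: integral_itv_obnd_cbnd; apply/measurable_EFinP; apply: measurable_funTS.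
exact: measurable_gamma_density.
Qed.

(** If [Gamma s] were 0, division by it would make the density identically 0, against total mass
    one. *)
Lemma gamma_law_Gamma_neq0 (s : R) (G : T -> R) : 0 < s ->
  (forall A, measurable A -> P (G @^-1` A) = gamma_law s A) -> Gamma s != 0.
Proof.
move=> s0 /(integral_gamma_density s0) h; apply/eqP => G0; move: h.
rewrite integral0_eq; first by move=> /eqP; rewrite eq_sym onee_eq0.
by move=> x _; rewrite /gamma_density G0 invr0 mulr0.
Qed.

Variables (r m : R) (G1 G2 : T -> R).
Hypotheses (hr : 0 < r <= 1) (m0 : 0 < m).
Hypotheses (mG1 : measurable_fun setT G1) (mG2 : measurable_fun setT G2).
Hypothesis hG1 : forall A, measurable A -> P (G1 @^-1` A) = gamma_law r A.
Hypothesis hG2 : forall A, measurable A -> P (G2 @^-1` A) = gamma_law (1 - r) A.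
Hypothesis hind : forall A B, measurable A -> measurable B ->
  (P (G1 @^-1` A `&` G2 @^-1` B) = P (G1 @^-1` A) * P (G2 @^-1` B))%E.

Let r0 : 0 < r. Proof. by case/andP: hr. Qed.

Let Gr : Gamma r != 0. Proof. exact: gamma_law_Gamma_neq0 r0 hG1. Qed.

(** The absolute value makes [phi] nonnegative on the whole plane, so Tonelli applies before
    anything is said about the signs of [G1] and [G2]. *)
Let z (x y : R) := `|m * (x + y) / x|.
Let phi (u x y : R) := z x y * expR (- z x y * u).
Let phi_ge0 u x y : 0 <= phi u x y.
Proof. by rewrite /phi mulr_ge0 ?expR_ge0 ?normr_ge0. Qed.

Let mphi u : measurable_fun setT (fun v : R * R => phi u v.1 v.2).
Proof. by rewrite /phi /z; mfun. Qed.

Let integral_phi u : 0 < u ->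
  (\int[P]_w (phi u (G1 w) (G2 w))%:E =
   \int[leb]_(x in I) \int[P]_w (phi u x (G2 w) * gamma_density r x)%:E)%E.
Proof.
move=> u0.
rewrite (@ge0_integral_indep _ _ _ P _ _ R R G1 G2 (fun v => (phi u v.1 v.2)%:E))//.
- transitivity (\int[P]_w \int[leb]_(x in I) (phi u x (G2 w) * gamma_density r x)%:E)%E.
    apply: eq_integral => w _ /=.
    rewrite (ge0_integral_density mG1 (measurable_gamma_density r) _ _ _
      (gamma_law_density r0 hG1) (f := phi u ^~ (G2 w)))//.
    + by rewrite /phi /z; mfun; exact: measurable_inv.
    + by move=> x _; exact: gamma_density_ge0.
  rewrite (@tonelli_in _ _ T (measurableTypeR R) R P leb setT I _ _
    (fun w x => (phi u x (G2 w) * gamma_density r x)%:E))//.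
  + by rewrite /phi /z /gamma_density; mfun.
  + by move=> w x _ _; rewrite lee_fin mulr_ge0 ?phi_ge0 ?gamma_density_ge0.
- exact/measurable_EFinP.
- by move=> v; rewrite lee_fin phi_ge0.
Qed.

(** Here [G2] has the Dirac law at 0 and no density, so this case is separate: the ratio is almost
    surely the constant m. *)
Let laplace_r1 u : 0 < u -> r = 1 ->
  (\int[P]_w (phi u (G1 w) (G2 w))%:E =
   (m `^ r * u `^ (r - 1) * expR (- m * u) / Gamma r)%:E)%E.
Proof.
move=> u0 r1; rewrite integral_phi//.
have ae0 : {ae P, forall w, G2 w = 0}.
  have m0' : measurable (~` [set (0 : R)]) by apply: measurableC; exact: measurable_set1.
  exists (G2 @^-1` (~` [set 0])); split => //.
  - exact: measurable_preimage.
  - apply: (eq_trans (hG2 m0')); rewrite /gamma_law r1 subrr eqxx indicE.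
    by rewrite memNset//=; apply.
transitivity (\int[leb]_(x in I) ((m * expR (- m * u))%:E * (gamma_density r x)%:E))%E.
  apply: eq_integral => x; rewrite inE/= in_itv/= andbT => x0.
  transitivity (\int[P]_w (cst (m * expR (- m * u) * gamma_density r x)%:E w))%E.
    apply: ae_eq_integral => //.
    - by rewrite /phi /z; mfun.
    - apply: filterS ae0 => w -> _ /=; congr EFin; congr (_ * _).
      by rewrite /phi /z addr0 mulfK ?gt_eqF// gtr0_norm.
  by rewrite integral_cst// [X in (_ * X)%E]probability_setT mule1 EFinM.
rewrite ge0_integralZl//; last 3 first.
- by apply/measurable_EFinP; apply: measurable_funTS; exact: measurable_gamma_density.
- by move=> x _; rewrite lee_fin gamma_density_ge0.
- by rewrite lee_fin mulr_ge0 ?expR_ge0 ?(ltW m0).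
rewrite (integral_gamma_density r0 hG1) mule1 r1 Gamma1 subrr powRr0 powRr1 ?(ltW m0)//.
by rewrite mulr1 divr1.
Qed.

Let laplace_rlt1 u : 0 < u -> r < 1 ->
  (\int[P]_w (phi u (G1 w) (G2 w))%:E =
   (m `^ r * u `^ (r - 1) * expR (- m * u) / Gamma r)%:E)%E.
Proof.
move=> u0 r1; rewrite integral_phi//.
have s0 : 0 < 1 - r by rewrite subr_gt0.
have Gs : Gamma (1 - r) != 0 := gamma_law_Gamma_neq0 s0 hG2.
pose c := u * m; have c0 : 0 < c by rewrite mulr_gt0.
(* What remains free of x after y = x v: the ratio becomes m (1 + v), and x enters only through
   e^(-(1 + v) x). *)
pose C v := m * (1 + v) * expR (- (m * (1 + v)) * u) * v `^ (1 - r - 1) / (Gamma r * Gamma (1 - r)).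
have C_ge0 v : 0 < v -> 0 <= C v.
  move=> v0; rewrite divr_ge0 ?mulr_ge0 ?Gamma_ge0 ?powR_ge0 ?expR_ge0 ?(ltW m0)//.
  by rewrite addr_ge0 ?(ltW v0).
transitivity (\int[leb]_(x in I) \int[leb]_(v in I) (C v * expR (- (1 + v) * x))%:E)%E.
  apply: eq_integral => x; rewrite inE/= in_itv/= andbT => x0.
  have mf : measurable_fun setT (phi u x) by rewrite /phi /z; mfun.
  transitivity ((gamma_density r x)%:E * \int[P]_w (phi u x (G2 w))%:E)%E.
    rewrite -ge0_integralZl//.
    - by apply: eq_integral => w _; rewrite -EFinM mulrC.
    - by apply/measurable_EFinP; exact: measurableT_comp mG2.
    - by move=> w _; rewrite lee_fin phi_ge0.
    - by rewrite lee_fin gamma_density_ge0.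
  rewrite (ge0_integral_density mG2 (measurable_gamma_density (1 - r)) mf _ _
    (gamma_law_density s0 hG2))//; last first.
    by move=> y _; exact: gamma_density_ge0.
  rewrite (integral_half_line_scale x0); last 2 first.
  - by apply/measurable_EFinP/measurable_funM => //; exact: measurable_gamma_density.
  - by move=> y _; rewrite lee_fin mulr_ge0 ?phi_ge0 ?gamma_density_ge0.
  rewrite muleA -EFinM -ge0_integralZl//.
  - apply: eq_integral => v; rewrite inE/= in_itv/= andbT => v0; rewrite -EFinM; congr EFin.
    have e1 : z x (x * v) = m * (1 + v).
      rewrite /z (_ : m * (x + x * v) / x = m * (1 + v)); last by field; rewrite gt_eqF.
      by rewrite gtr0_norm// mulr_gt0// addr_gt0.
    rewrite /phi e1 /gamma_density /C powRM ?(ltW x0) ?(ltW v0)//.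
    rewrite (_ : - (1 + v) * x = - x + - (x * v)) ?expRD; last by ring.
    (* The two densities and the Jacobian x contribute powers of x whose exponents sum to 0. *)
    have e2 : x `^ (r - 1) * x * x `^ (1 - r - 1) = 1.
      rewrite mulrAC -powRD; last by apply/implyP => _; rewrite gt_eqF.
      by rewrite (_ : r - 1 + (1 - r - 1) = - 1) ?powR_inv1 ?(ltW x0) ?mulVf ?gt_eqF//; ring.
    rewrite -[RHS]mul1r -[X in _ = X * _]e2; field.
    by rewrite Gr Gs.
  - apply/measurable_EFinP; rewrite /gamma_density; apply: measurable_funM.
      by rewrite /phi /z; mfun.
    by mfun.
  - by move=> v _; rewrite lee_fin mulr_ge0 ?phi_ge0 ?gamma_density_ge0.
  - by rewrite lee_fin mulr_ge0 ?gamma_density_ge0 ?(ltW x0).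
rewrite (@tonelli_in _ _ (measurableTypeR R) (measurableTypeR R) R leb leb I I mI mI
  (fun x v => (C v * expR (- (1 + v) * x))%:E)); last 2 first.
- by rewrite /C; mfun.
- move=> x v _; rewrite /= in_itv/= andbT => v0.
  by rewrite lee_fin mulr_ge0 ?C_ge0 ?expR_ge0.
(* Integrating over x gives 1 / (1 + v), which cancels the 1 + v of the ratio. The factor c^r
   compensates for writing v^(-r) as (c v)^(-r), so that a rescaled Gamma integrand is left. *)
pose K := m * expR (- m * u) * c `^ r / (Gamma r * Gamma (1 - r)).
have K0 : 0 <= K.
  by rewrite divr_ge0 ?mulr_ge0 ?Gamma_ge0 ?powR_ge0 ?expR_ge0 ?(ltW m0).
transitivity (\int[leb]_(v in I) (K%:E * ((c * v) `^ (1 - r - 1) * expR (- (c * v)))%:E))%E.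
  apply: eq_integral => v; rewrite inE/= in_itv/= andbT => v0.
  have v1 : 0 < 1 + v by rewrite addr_gt0.
  under eq_integral do rewrite EFinM.
  rewrite ge0_integralZl//; last 2 first.
  - by mfun.
  - by rewrite lee_fin C_ge0.
  rewrite integral_expR_half_line// -!EFinM; congr EFin.
  rewrite /K /C (@powRM _ c v) ?(ltW c0) ?(ltW v0)//.
  have e2 : c `^ r * c `^ (1 - r - 1) = 1.
    rewrite -powRD; last by apply/implyP => _; rewrite gt_eqF.
    by rewrite (_ : r + (1 - r - 1) = 0) ?powRr0//; ring.
  rewrite (_ : - (m * (1 + v)) * u = - m * u + - (c * v)) ?expRD; last by rewrite /c; ring.
  rewrite -[LHS]mul1r -[X in X * _ = _]e2; field.
  by rewrite Gr Gs gt_eqF.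
rewrite ge0_integralZl//; last 2 first.
- by mfun.
- by move=> v _; rewrite lee_fin mulr_ge0 ?powR_ge0 ?expR_ge0.
have h := Gamma_integral Gs; rewrite (integral_half_line_scale c0) in h; last 2 first.
- by mfun.
- by move=> x _; rewrite lee_fin mulr_ge0 ?powR_ge0 ?expR_ge0.
have -> : (\int[leb]_(v in I) ((c * v) `^ (1 - r - 1) * expR (- (c * v)))%:E =
    (c^-1 * Gamma (1 - r))%:E)%E.
  by rewrite EFinM -h muleA -EFinM mulVf ?gt_eqF// mul1e.
rewrite -EFinM; congr EFin; rewrite /K.
have -> : m `^ r = m * m `^ (r - 1) by rewrite mulr_powRB1// ltW.
have -> : c `^ r = c * c `^ (r - 1) by rewrite mulr_powRB1// ltW.
have -> : c `^ (r - 1) = u `^ (r - 1) * m `^ (r - 1) by rewrite /c powRM ?(ltW u0) ?(ltW m0).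
move: (c) c0 => c' c'0; field.
by rewrite Gr Gs gt_eqF.
Qed.

Lemma gamma_ratio_laplace u : 0 < u ->
  (\int[P]_w (`|m * (G1 w + G2 w) / G1 w| * expR (- `|m * (G1 w + G2 w) / G1 w| * u))%:E =
   (m `^ r * u `^ (r - 1) * expR (- m * u) / Gamma r)%:E)%E.
Proof.
move=> u0; have /andP[_] := hr; rewrite le_eqVlt => /predU1P[r1|r1].
  exact: laplace_r1.
exact: laplace_rlt1.
Qed.

Lemma gamma_law_le0 : P [set w | G1 w <= 0] = 0%E.
Proof.
rewrite (_ : [set w | _] = G1 @^-1` `]-oo, 0]%classic); last first.
  by apply/seteqP; split => w /=; rewrite in_itv.
rewrite (gamma_law_density r0 hG1)//.
rewrite (_ : _ `&` _ = [set 0]) ?integral_set1//.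
apply/seteqP; split => x /=; rewrite !in_itv/= andbT.
  by move=> [h1 h2]; apply/eqP; rewrite eq_le h1 h2.
by move=> ->; rewrite lexx.
Qed.

Lemma gamma_law_lt0 : P [set w | G2 w < 0] = 0%E.
Proof.
rewrite (_ : [set w | _] = G2 @^-1` `]-oo, 0[%classic); last first.
  by apply/seteqP; split => w /=; rewrite in_itv.
have /andP[_] := hr; rewrite le_eqVlt => /predU1P[r1|r1].
  rewrite hG2//.
  by rewrite /gamma_law r1 subrr eqxx indicE memNset//= in_itv/= ltxx.
have s0 : 0 < 1 - r by rewrite subr_gt0.
rewrite (gamma_law_density s0 hG2)//.
rewrite (_ : _ `&` _ = set0) ?integral_set0//.
apply/seteqP; split => x //=; rewrite !in_itv/= andbT => -[h1 h2].
by move: (lt_le_trans h1 h2); rewrite ltxx.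
Qed.

End gamma_ratio.

(** * The generalized negative binomial law *)

Section main.
Context {R : realType} (r alpha mu : R).
Hypotheses (hr : 0 < r <= 1) (ha : 0 < alpha <= 1) (hmu : 0 < mu).
Context {d : measure_display} {T : measurableType d} (P : probability T R).
Variables (S G1 G2 : T -> R).
Hypotheses (mS : measurable_fun setT S) (mG1 : measurable_fun setT G1)
  (mG2 : measurable_fun setT G2).
Hypotheses (hS : stable_charfun P alpha S)
  (hG1 : forall A, measurable A -> P (G1 @^-1` A) = gamma_law r A)
  (hG2 : forall A, measurable A -> P (G2 @^-1` A) = gamma_law (1 - r) A)
  (hind : indep3 P S G1 G2).
Local Notation leb := (@lebesgue_measure R).
Local Notation I := (`]0, +oo[%classic : set R).

Let Z w := mu * (G1 w + G2 w) / G1 w.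
Let Y w := S w * Z w `^ alpha^-1 / (1 + S w * Z w `^ alpha^-1).
Let Y' w := mu `^ alpha^-1 * S w * (G1 w + G2 w) `^ alpha^-1 /
  (G1 w `^ alpha^-1 + mu `^ alpha^-1 * S w * (G1 w + G2 w) `^ alpha^-1).

(** Off this null set the powers and quotients defining Y behave as for positive numbers. For [G2]
    only the negative values are discarded, since [G2] is almost surely 0 when r = 1. *)
Let N := [set w | S w <= 0] `|` [set w | G1 w <= 0] `|` [set w | G2 w < 0].

Let a0 : 0 < alpha. Proof. by case/andP: ha. Qed.
Let r0 : 0 < r. Proof. by case/andP: hr. Qed.

Let mI : measurable (I : set (measurableTypeR R)).
Proof. exact: measurable_itv. Qed.

Let mSle0 : measurable [set w | S w <= 0].
Proof.
rewrite (_ : [set w | _] = S @^-1` `]-oo, 0]%classic); first exact: measurable_preimage.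
by apply/seteqP; split => w /=; rewrite in_itv.
Qed.

Let mG1le0 : measurable [set w | G1 w <= 0].
Proof.
rewrite (_ : [set w | _] = G1 @^-1` `]-oo, 0]%classic); first exact: measurable_preimage.
by apply/seteqP; split => w /=; rewrite in_itv.
Qed.

Let mG2lt0 : measurable [set w | G2 w < 0].
Proof.
rewrite (_ : [set w | _] = G2 @^-1` `]-oo, 0[%classic); first exact: measurable_preimage.
by apply/seteqP; split => w /=; rewrite in_itv.
Qed.

Let mN : measurable N.
Proof. by apply: measurableU => //; exact: measurableU. Qed.

Let PSle0 : P [set w | S w <= 0] = 0%E.
Proof.
rewrite -(stable_le0 ha mS hS); congr (P _).
by apply/seteqP; split => w /=; rewrite in_itv/= andbT leNgt => /negP.
Qed.

Let PN : P N = 0%E.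
Proof.
rewrite null_set_setU//.
- exact: measurableU.
- by rewrite null_set_setU//; exact: gamma_law_le0 hr hG1.
- exact: gamma_law_lt0 hr hG2.
Qed.

Let NE w : ~ N w -> [/\ 0 < S w, 0 < G1 w & 0 <= G2 w].
Proof.
move=> Nw; split.
- by rewrite ltNge; apply/negP => h; apply: Nw; left; left.
- by rewrite ltNge; apply/negP => h; apply: Nw; left; right.
- by rewrite leNgt; apply/negP => h; apply: Nw; right.
Qed.

Let Z_gt0 w : ~ N w -> 0 < Z w.
Proof.
by move=> /NE[_ g1 g2]; rewrite divr_gt0// mulr_gt0// ltr_pwDl.
Qed.

Let W_gt0 w : ~ N w -> 0 < S w * Z w `^ alpha^-1.
Proof. by move=> Nw; have [s _ _] := NE Nw; rewrite mulr_gt0// powR_gt0// Z_gt0. Qed.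

(** Numerator and denominator are multiplied by G1^(1/alpha). The equality in law of the two
    expressions is thus obtained from almost sure equality. *)
Let YE w : ~ N w -> Y w = Y' w.
Proof.
move=> Nw; have [s g1 g2] := NE Nw; rewrite /Y /Y' /Z.
have g12 : 0 <= G1 w + G2 w by rewrite addr_ge0// ltW.
have q0 : 0 < G1 w `^ alpha^-1 by rewrite powR_gt0.
rewrite !powRM ?mulr_ge0 ?invr_ge0 ?(ltW hmu) ?(ltW g1)//.
have -> : (G1 w)^-1 `^ alpha^-1 = (G1 w `^ alpha^-1)^-1.
  by rewrite -(powR_inv1 (ltW g1)) powRAC powR_inv1 ?powR_ge0.
have p0 : 0 <= (G1 w + G2 w) `^ alpha^-1 by exact: powR_ge0.
have m0 : 0 < mu `^ alpha^-1 by rewrite powR_gt0.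
move: (G1 w `^ _) ((G1 w + G2 w) `^ _) (mu `^ _) q0 p0 m0 => q p m q0 p0 m0.
have h : 0 < q + m * S w * p by rewrite ltr_pwDl// !mulr_ge0// ltW.
by field; rewrite !gt_eqF.
Qed.

Let Y_itv w : ~ N w -> Y w \in `]0, 1[.
Proof.
move=> /W_gt0 W0; rewrite in_itv/= /Y.
have W1 : 0 < 1 + S w * Z w `^ alpha^-1 by rewrite addr_gt0.
by rewrite divr_gt0//= ltr_pdivrMr// mul1r ltrDr.
Qed.

Let mZ : measurable_fun setT Z. Proof. by rewrite /Z; mfun. Qed.
Let mY : measurable_fun setT Y. Proof. by rewrite /Y; mfun. Qed.
Let mY' : measurable_fun setT Y'. Proof. by rewrite /Y'; mfun. Qed.

Let P_eq_off_null (E F : set T) : measurable E -> measurable F ->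
  (forall w, ~ N w -> E w <-> F w) -> P E = P F.
Proof.
move=> mE mF EF.
have h A : measurable A -> P A = P (A `\` N).
  move=> mA; transitivity (P (A `\` N) + P (A `&` N))%E; first exact: measureDI.
  have -> : P (A `&` N) = 0%E.
    by apply: (subset_measure0 (measurableI _ _ mA mN) mN) => //; exact: subIsetr.
  by rewrite adde0.
rewrite h// [RHS]h//; congr (P _).
by apply/seteqP; split => w [h1 h2]; split => //; apply/EF.
Qed.

Let P_Y_itv : P (Y @^-1` `]0, 1[) = 1%E.
Proof.
rewrite -(@probability_setT _ _ _ P); apply: P_eq_off_null => //.
  exact: measurable_preimage.
by move=> w Nw; split => // _; exact: Y_itv.
Qed.

Let P_Y_Y' A : measurable A -> P (Y @^-1` A) = P (Y' @^-1` A).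
Proof.
move=> mA; apply: P_eq_off_null; [exact: measurable_preimage..|].
by move=> w /YE YY'; rewrite /preimage /= YY'.
Qed.

(* Absolute values make the integrand nonnegative everywhere; they are immaterial
   off the null set N. *)
Let z (x y : R) := `|mu * (x + y) / x|.
Let h k (v : R * (R * R)) : R :=
  let W := `|v.1| * z v.2.1 v.2.2 `^ alpha^-1 in W / (1 + W) ^+ k.+1.

Let W_ge0 (v : R * (R * R)) : 0 <= `|v.1| * z v.2.1 v.2.2 `^ alpha^-1.
Proof. by rewrite mulr_ge0 ?powR_ge0. Qed.

Let h_ge0 k v : 0 <= h k v.
Proof. by rewrite /h divr_ge0 ?W_ge0// exprn_ge0// addr_ge0// W_ge0. Qed.

Let mh k : measurable_fun setT (h k).
Proof. by rewrite /h /z; mfun. Qed.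

Let integral_off_N (D : set T) (f g : T -> R) : measurable D ->
  (forall w, ~ N w -> D w) ->
  measurable_fun D f -> measurable_fun setT g ->
  (forall w, D w -> 0 <= f w) -> (forall w, 0 <= g w) ->
  (forall w, ~ N w -> f w = g w) ->
  (\int[P]_(w in D) (f w)%:E = \int[P]_w (g w)%:E)%E.
Proof.
move=> mD DN mf mg f0 g0 fg.
rewrite (ge0_negligible_integral mN mD _ _ PN)//; last first.
  exact/measurable_EFinP.
rewrite [RHS](ge0_negligible_integral mN _ _ _ PN)//; last 2 first.
- exact/measurable_EFinP.
- by move=> w _; rewrite lee_fin.
rewrite (_ : D `\` N = setT `\` N); last first.
  by apply/seteqP; split => w [? ?]; split => //; exact: DN.
by apply: eq_integral => w; rewrite inE => -[_ Nw]; rewrite fg.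
Qed.

Let integral_Y k : (\int[pushforward P Y]_(y in `]0%R, 1%R[) (y * (1 - y) ^+ k)%:E =
  \int[P]_w (h k (S w, (G1 w, G2 w)))%:E)%E.
Proof.
have mf : measurable_fun setT (fun y : R => y * (1 - y) ^+ k) by mfun.
rewrite (ge0_integral_pushforward mY)//; last 2 first.
- by apply/measurable_EFinP; exact: measurable_funTS.
- move=> y; rewrite inE/= in_itv/= => /andP[y0 y1].
  by rewrite lee_fin mulr_ge0 ?(ltW y0)// exprn_ge0// subr_ge0 ltW.
apply: integral_off_N.
- exact: measurable_preimage.
- by move=> w /Y_itv.
- by apply: measurable_funTS; exact: (measurableT_comp mf mY).
- by apply: (measurableT_comp (mh k)); apply: measurable_fun_pair => //; exact: measurable_fun_pair.
- move=> w; rewrite /= in_itv/= => /andP[y0 y1].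
  by rewrite mulr_ge0 ?(ltW y0)// exprn_ge0// subr_ge0 ltW.
- by move=> w; exact: h_ge0.
- move=> w Nw; have W0 := W_gt0 Nw; have [s _ _] := NE Nw.
  rewrite /h /z /= -/(Z w) (gtr0_norm s) (gtr0_norm (Z_gt0 Nw)) /Y.
  move: (S w * _) W0 => W W0; have W1 : 1 + W != 0 by rewrite gt_eqF// addr_gt0.
  rewrite (_ : 1 - W / (1 + W) = (1 + W)^-1); last by field.
  by rewrite exprS invfM exprVn mulrA.
Qed.

(** The part of the mixture integrand that does not involve the gamma variables and leaves their
    expectation as a factor. *)
Let density k (t : R) := t ^+ k / k`!%:R * expR (- t) * (alpha * t `^ (alpha - 1)).

Let integral_h k x y :
  (\int[P]_w (h k (S w, (x, y)))%:E =
   \int[leb]_(t in I) (density k t * (z x y * expR (- z x y * t `^ alpha)))%:E)%E.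
Proof.
(* For arbitrary reals [z x y] may be 0, for instance at x = 0, where division yields 0. Both sides
   then vanish; otherwise [stable_mixture] applies. *)
have := normr_ge0 (mu * (x + y) / x); rewrite le_eqVlt -/(z x y) => /predU1P[z0|z0].
  rewrite !integral0_eq// => [t _|w _].
    by rewrite -z0 mul0r mulr0.
  by rewrite /h /= -z0 powR0 ?invr_neq0 ?gt_eqF// mulr0 mul0r.
have e := stable_mixture ha mS hS k z0.
transitivity (\int[leb]_(t in I) (t ^+ k / k`!%:R * expR (- t) *
  (alpha * t `^ (alpha - 1) * (z x y * expR (- z x y * t `^ alpha))))%:E)%E; last first.
  by apply: eq_integral => t _; congr EFin; rewrite /density mulrA.
rewrite -e; apply/esym; apply: integral_off_N.
- exact: measurable_preimage.
- by move=> w /NE[s _ _]; rewrite /= in_itv/= s.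
- by mfun.
- by rewrite /h /=; mfun.
- move=> w; rewrite /= in_itv/= andbT => s.
  by rewrite divr_ge0 ?exprn_ge0 ?addr_ge0 ?mulr_ge0 ?powR_ge0 ?(ltW s).
- by move=> w; exact: h_ge0.
- by move=> w /NE[s _ _]; rewrite /h /= (gtr0_norm s).
Qed.

Let mixed_geometric k : GNB_pmf r alpha mu k =
  (\int[pushforward P Y]_(y in `]0%R, 1%R[) (y * (1 - y) ^+ k)%:E)%E.
Proof.
rewrite integral_Y.
have mG : measurable_fun setT (fun w => (G1 w, G2 w)) by exact: measurable_fun_pair.
have hG := indep3_pair mS mG1 mG2 hind.
have h12 A B : measurable A -> measurable B ->
    (P (G1 @^-1` A `&` G2 @^-1` B) = P (G1 @^-1` A) * P (G2 @^-1` B))%E.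
  move=> mA mB; have := hind measurableT mA mB.
  by rewrite preimage_setT setTI probability_setT mul1e.
rewrite (@ge0_integral_indep _ _ _ P _ _ R (R * R)%type S
  (fun w => (G1 w, G2 w)) (EFin \o h k))//; last 2 first.
- exact/measurable_EFinP.
- by move=> v; rewrite lee_fin h_ge0.
transitivity (\int[P]_w \int[leb]_(t in I)
    (density k t * (z (G1 w) (G2 w) * expR (- z (G1 w) (G2 w) * t `^ alpha)))%:E)%E; last first.
  by apply: eq_integral => w _ /=; rewrite integral_h.
have dens_ge0 t : 0 < t -> 0 <= density k t.
  by move=> t0; rewrite !mulr_ge0 ?expR_ge0 ?powR_ge0 ?invr_ge0 ?exprn_ge0 ?(ltW t0) ?(ltW a0).
rewrite (@tonelli_in _ _ T (measurableTypeR R) R P leb setT I _ _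
  (fun w t => (density k t *
    (z (G1 w) (G2 w) * expR (- z (G1 w) (G2 w) * t `^ alpha)))%:E))//; last 2 first.
- by rewrite /density /z; mfun.
- move=> w t _; rewrite /= in_itv/= andbT => t0.
  by rewrite lee_fin mulr_ge0 ?dens_ge0// mulr_ge0 ?expR_ge0// normr_ge0.
rewrite /GNB_pmf -integral_itv_obnd_cbnd; last by rewrite /gg_density; mfun.
apply: eq_integral => t; rewrite inE/= in_itv/= andbT => t0.
under eq_integral do rewrite EFinM.
rewrite ge0_integralZl//; last 3 first.
- by rewrite /z; mfun.
- by move=> w _; rewrite lee_fin mulr_ge0 ?expR_ge0// normr_ge0.
- by rewrite lee_fin dens_ge0.
have ta : 0 < t `^ alpha by rewrite powR_gt0.
rewrite (gamma_ratio_laplace hr hmu mG1 mG2 hG1 hG2 h12 ta) -EFinM; congr EFin.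
rewrite /gg_density /density (gtr0_norm a0) -powRrM.
(* The exponent of the generalized gamma density splits into that of the Weibull factor and that of
   u^(r-1) at u = t^alpha. *)
have -> : alpha * r - 1 = (alpha - 1) + alpha * (r - 1) by ring.
rewrite powRD; last by apply/implyP => _; rewrite gt_eqF.
by ring.
Qed.

Lemma gnb_mixed_geometric :
  [/\ P (Y @^-1` `]0, 1[) = 1%E,
      (forall A, measurable A -> P (Y @^-1` A) = P (Y' @^-1` A)) &
      forall k : nat,
        GNB_pmf r alpha mu k =
        (\int[pushforward P Y]_(y in `]0%R, 1%R[) (y * (1 - y) ^+ k)%:E)%E].
Proof. by split; [exact: P_Y_itv|exact: P_Y_Y'|exact: mixed_geometric]. Qed.

End main.

Unset Implicit Arguments.

Theorem theorem2 (R : realType) (r alpha mu : R)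
  (hr : 0 < r <= 1) (ha : 0 < alpha <= 1) (hmu : 0 < mu)
  (d : measure_display) (T : measurableType d) (P : probability T R)
  (S G1 G2 : T -> R)
  (mS : measurable_fun setT S) (mG1 : measurable_fun setT G1)
  (mG2 : measurable_fun setT G2)
  (hS : stable_charfun P alpha S)
  (hG1 : forall A, measurable A -> P (G1 @^-1` A) = gamma_law r A)
  (hG2 : forall A, measurable A -> P (G2 @^-1` A) = gamma_law (1 - r) A)
  (hind : indep3 P S G1 G2) :
  let Z := fun w => mu * (G1 w + G2 w) / G1 w in
  let Y := fun w => S w * Z w `^ alpha^-1 / (1 + S w * Z w `^ alpha^-1) in
  let Y' := fun w =>
    mu `^ alpha^-1 * S w * (G1 w + G2 w) `^ alpha^-1 /
    (G1 w `^ alpha^-1 + mu `^ alpha^-1 * S w * (G1 w + G2 w) `^ alpha^-1) in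
  [/\ P (Y @^-1` `]0, 1[) = 1%E,
      (forall A, measurable A -> P (Y @^-1` A) = P (Y' @^-1` A)) &
      forall k : nat,
        GNB_pmf r alpha mu k =
        (\int[pushforward P Y]_(y in `]0%R, 1%R[) (y * (1 - y) ^+ k)%:E)%E].
Proof. exact: gnb_mixed_geometric. Qed.
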